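(* Let $L$ be a finite-dimensional Lie algebra over a field $\mathbb{F}$ of prime characteristic. Then the following statements are equivalent: (i) $L$ is solvable. (ii) $H^1(L/\operatorname{Ann}_L(S),S)=0$ for every irreducible $L$-module $S$. (iii) $\dim_{\mathbb{F}} H^1(L,S)=\dim_{\mathbb{F}}\operatorname{End}_L(S)\cdot[L:S]_{\rm split}$ holds for every irreducible $L$-module $S$.
   Context: $H^n(L,M)$ denotes the ordinary (Chevalley–Eilenberg) cohomology of a Lie algebra $L$ with coefficients in an $L$-module $M$. $\operatorname{Ann}_L(S):=\{x\in L\mid x\cdot s=0 \text{ for all } s\in S\}$, and $S$ is regarded as an $L/\operatorname{Ann}_L(S)$-module in the natural way. (Irreducible modules of a finite-dimensional Lie algebra over a field of prime characteristic are finite-dimensional.) A chief series of a finite-dimensional Lie algebra $L$ is an ascending chain $0=L_0\subset L_1\subset\cdots\subset L_n=L$ of ideals of $L$ such that $L_j/L_{j-1}$ is a minimal (non-zero) ideal of $L/L_{j-1}$ for every $1\le j\le n$; each $L_j/L_{j-1}$ is called a chief factor, and it is an $L$-module via the adjoint action. It is called an abelian chief factor if it is an abelian Lie algebra. For a finite-dimensional irreducible $L$-module $S$ and a given chief series of $L$, $[L:S]_{\rm split}$ denotes the number of indices $j$ such that $L_j/L_{j-1}$ is an abelian chief factor isomorphic to $S$ as an $L$-module and the exact sequence $0\to L_j/L_{j-1}\to L/L_{j-1}\to L/L_j\to 0$ splits in the category of Lie algebras. This number does not depend on the choice of the chief series. *)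

(* Defs.v *)
(* Finite-dimensional Lie algebras and their finite-dimensional modules. In
   prime characteristic every irreducible module of a finite-dimensional Lie
   algebra is finite-dimensional, so modules are carried by a vectType. *)
From HB Require Import structures.
From mathcomp Require Import all_boot all_order all_algebra.
From mathcomp Require Import boolp.

Set Implicit Arguments.
Unset Strict Implicit.
Unset Printing Implicit Defensive.

Import GRing.Theory.
Local Open Scope ring_scope.

Section LinearMaps.
Variables (F : fieldType) (V W : vectType F).

Definition hom_of (f : V -> W) (lf : linear f) : 'Hom(V, W) :=
  linfun (HB.pack_for {linear V -> W} f (GRing.isLinear.Build F V W *:%R f lf)).

Lemma hom_ofE (f : V -> W) (lf : linear f) v : hom_of lf v = f v.
Proof. by rewrite lfunE. Qed.

End LinearMaps.

(* The quotient V / U is carried by the complement U^C that MathComp attaches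
   to U; vpi is the canonical projection (vpi_surj, lker_vpi) and vrepr picks
   a representative (vreprK). *)
Section Quotient.
Variables (F : fieldType) (V : vectType F) (U : {vspace V}).

Definition vquot : Type := subvs_of (U^C)%VS.
HB.instance Definition _ := Vector.on vquot.

Definition vrepr (u : vquot) : V := vsval u.
Fact vrepr_linear : linear vrepr.
Proof. by move=> a u v; exact: (linearP (vsval : subvs_of (U^C)%VS -> V)). Qed.
HB.instance Definition _ :=
  GRing.isLinear.Build F vquot V *:%R vrepr vrepr_linear.

Fact vpi_linear :
  linear ((fun v => vsproj (U^C)%VS (daddv_pi (U^C)%VS U v)) : V -> vquot).
Proof. by move=> a u v; rewrite !linearP. Qed.

Definition vpi : 'Hom(V, vquot) := hom_of vpi_linear.

Let capCU : (U^C :&: U = 0)%VS. Proof. by rewrite capvC capv_compl. Qed.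

Lemma vreprK : cancel vrepr vpi.
Proof.
move=> u; apply: val_inj; rewrite hom_ofE /= daddv_pi_id ?subvsP //.
by rewrite vsprojK ?subvsP.
Qed.

Lemma vpi_surj : limg vpi = fullv.
Proof.
apply/vspaceP=> u; rewrite memvf; apply/memv_imgP.
by exists (vrepr u); rewrite ?memvf ?vreprK.
Qed.

Lemma vpi_reprB v : v - vrepr (vpi v) \in U.
Proof.
rewrite hom_ofE /vrepr vsprojK ?memv_pi //.
have {1}<- := @daddv_pi_add _ _ _ _ v capCU; last first.
  by rewrite addvC addv_complf memvf.
by rewrite addrC addKr memv_pi.
Qed.

Lemma lker_vpi : lker vpi = U.
Proof.
apply/eqP; rewrite eqEsubv; apply/andP; split; apply/subvP=> v; rewrite memv_ker.
  by move/eqP=> v0; have := vpi_reprB v; rewrite v0 !linear0 addr0.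
move=> Uv; apply/eqP/val_inj; rewrite linear0.
apply/eqP; rewrite -memv0 -capCU memv_cap subvsP /=.
by rewrite -[X in X \in _](subKr v) memvB // vpi_reprB.
Qed.

Lemma vpi_eqP v w : reflect (vpi v = vpi w) (v - w \in U).
Proof. by rewrite -[in _ \in _]lker_vpi memv_ker linearB subr_eq0; apply: eqP. Qed.

End Quotient.

HB.mixin Record isLieAlgebra (F : fieldType) L of Vector F L := {
  lie_bracket : L -> L -> L;
  lie_linearl : forall y, linear (lie_bracket^~ y);
  lie_linearr : forall x, linear (lie_bracket x);
  lie_xx : forall x, lie_bracket x x = 0;
  lie_jacobi : forall x y z,
    lie_bracket x (lie_bracket y z) + lie_bracket y (lie_bracket z x)
      + lie_bracket z (lie_bracket x y) = 0
}.

#[short(type="lieAlgType")]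
HB.structure Definition LieAlgebra (F : fieldType) :=
  { L of Vector F L & isLieAlgebra F L }.

Notation "[ 'lie' x , y ]" := (lie_bracket x y)
  (at level 0, x, y at level 99, format "[ 'lie'  x ,  y ]") : ring_scope.

Section LieTheory.
Variables (F : fieldType) (L : lieAlgType F).
Implicit Types (x y z : L) (U V W : {vspace L}).

Lemma lieDl x y z : [lie x + y, z] = [lie x, z] + [lie y, z].
Proof. by have := @lie_linearl F L z 1 x y; rewrite !scale1r. Qed.
Lemma lieDr x y z : [lie x, y + z] = [lie x, y] + [lie x, z].
Proof. by have := @lie_linearr F L x 1 y z; rewrite !scale1r. Qed.
Lemma lie0r x : [lie x, 0] = 0 :> L.
Proof. by apply: (addrI [lie x, 0]); rewrite -lieDr !addr0. Qed.
Lemma lie0l x : [lie 0, x] = 0 :> L.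
Proof. by apply: (addrI [lie 0, x]); rewrite -lieDl !addr0. Qed.
Lemma lieZr a x y : [lie x, a *: y] = a *: [lie x, y].
Proof. by have := @lie_linearr F L x a y 0; rewrite !addr0 lie0r addr0. Qed.
Lemma lieZl a x y : [lie a *: x, y] = a *: [lie x, y].
Proof. by have := @lie_linearl F L y a x 0; rewrite !addr0 lie0l addr0. Qed.
Lemma lieNr x y : [lie x, - y] = - [lie x, y].
Proof. by rewrite -scaleN1r lieZr scaleN1r. Qed.
Lemma lieNl x y : [lie - x, y] = - [lie x, y].
Proof. by rewrite -scaleN1r lieZl scaleN1r. Qed.
Lemma lieBr x y z : [lie x, y - z] = [lie x, y] - [lie x, z].
Proof. by rewrite lieDr lieNr. Qed.
Lemma lieBl x y z : [lie x - y, z] = [lie x, z] - [lie y, z].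
Proof. by rewrite lieDl lieNl. Qed.
Lemma lieC x y : [lie x, y] = - [lie y, x].
Proof.
apply/eqP; rewrite -addr_eq0; apply/eqP.
by have := @lie_xx F L (x + y); rewrite lieDl !lieDr !lie_xx add0r addr0.
Qed.

(* [U, V] is the subspace spanned by all brackets, see liespanP. *)
Definition liespan U V : {vspace L} :=
  <<[seq [lie x, y] | x <- vbasis U, y <- vbasis V]>>%VS.

Lemma mem_liespan U V x y : x \in U -> y \in V -> [lie x, y] \in liespan U V.
Proof.
move=> Ux Vy; rewrite (coord_vbasis Ux) (coord_vbasis Vy).
pose f (u : 'I_(\dim U)) := coord (vbasis U) u x *: (vbasis U)`_u.
apply: (big_ind (fun z => [lie z, _] \in _)).
- by rewrite lie0l mem0v.
- by move=> u v Hu Hv; rewrite lieDl memvD.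
move=> i _; apply: (big_ind (fun z => [lie _, z] \in _)).
- by rewrite lie0r mem0v.
- by move=> u v Hu Hv; rewrite lieDr memvD.
move=> j _; rewrite lieZl lieZr !memvZ // memv_span //.
by apply: allpairs_f; rewrite mem_nth ?size_tuple.
Qed.

Lemma liespanP U V W :
  reflect (forall x y, x \in U -> y \in V -> [lie x, y] \in W)
          (liespan U V <= W)%VS.
Proof.
apply: (iffP idP) => [/subvP sUVW x y Ux Vy | H].
  exact/sUVW/mem_liespan.
apply/span_subvP=> _ /allpairsP[[u v] /= [Uu Vv ->]].
by apply: H; apply: vbasis_mem.
Qed.

Definition lie_derived (n : nat) : {vspace L} :=
  iter n (fun U => liespan U U) fullv.

Definition lie_solvable : Prop := exists n, lie_derived n = 0%VS.

Definition is_ideal U : Prop := forall x y, y \in U -> [lie x, y] \in U.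

Record lieIdeal := LieIdeal {
  ideal_space :> {vspace L};
  idealP : is_ideal ideal_space
}.

(* minimal among the non-zero ideals *)
Definition minimal_ideal U : Prop :=
  [/\ is_ideal U, U <> 0%VS &
      forall V, is_ideal V -> (V <= U)%VS -> V = 0%VS \/ V = U].

End LieTheory.

Arguments lie_solvable {F} L.
Arguments lieIdeal {F} L.

Definition lie_morphism (F : fieldType) (A B : lieAlgType F) (f : 'Hom(A, B)) :=
  forall x y, f [lie x, y] = [lie f x, f y].

Section QuotientLie.
Variables (F : fieldType) (L : lieAlgType F) (I : lieIdeal L).

Lemma vpi_lie (x x' y y' : L) : vpi I x = vpi I x' -> vpi I y = vpi I y' ->
  vpi I [lie x, y] = vpi I [lie x', y'].
Proof.
move=> /vpi_eqP Ix /vpi_eqP Iy; apply/vpi_eqP.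
have ->: [lie x, y] - [lie x', y'] = [lie x - x', y] + [lie x', y - y'].
  by rewrite lieBl lieBr addrA subrK.
apply: memvD; last exact: idealP.
by rewrite lieC memvN; apply: idealP.
Qed.

Definition lieQuot : Type := vquot I.
HB.instance Definition _ := Vector.on lieQuot.

Let br (u v : lieQuot) : lieQuot := vpi I [lie vrepr u, vrepr v].

Let br_pi x y : br (vpi I x) (vpi I y) = vpi I [lie x, y].
Proof. by apply: vpi_lie; rewrite vreprK. Qed.

Let br_linearl y : linear (br^~ y).
Proof. by move=> a u v; rewrite /br linearP lieDl lieZl linearP. Qed.
Let br_linearr x : linear (br x).
Proof. by move=> a u v; rewrite /br linearP lieDr lieZr linearP. Qed.
Let br_xx x : br x x = 0.
Proof. by rewrite /br lie_xx linear0. Qed.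
Let br_jacobi x y z : br x (br y z) + br y (br z x) + br z (br x y) = 0.
Proof.
rewrite -[x]vreprK -[y]vreprK -[z]vreprK !br_pi -!linearD.
by rewrite lie_jacobi linear0.
Qed.

HB.instance Definition _ := isLieAlgebra.Build F lieQuot
  br_linearl br_linearr br_xx br_jacobi.

Definition lpi : 'Hom(L, lieQuot) := vpi I.
Definition lrepr (u : lieQuot) : L := vrepr u.

Lemma lpi_morphism : lie_morphism lpi.
Proof. by move=> x y; apply/esym/br_pi. Qed.

Lemma lreprK : cancel lrepr lpi. Proof. exact: vreprK. Qed.

End QuotientLie.

Record lieModule (F : fieldType) (L : lieAlgType F) (S : vectType F) :=
  LieModule {
    lact :> L -> S -> S;
    lact_linearl : forall s, linear (lact^~ s);
    lact_linearr : forall x, linear (lact x);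
    lact_lie : forall x y s,
      lact [lie x, y] s = lact x (lact y s) - lact y (lact x s)
  }.

Section Modules.
Variables (F : fieldType) (L : lieAlgType F).

Definition is_submodule (S : vectType F) (rho : lieModule L S)
    (T : {vspace S}) : Prop :=
  forall x s, s \in T -> rho x s \in T.

Definition irreducible (S : vectType F) (rho : lieModule L S) : Prop :=
  (fullv : {vspace S}) <> 0%VS /\
  forall T, is_submodule rho T -> T = 0%VS \/ T = fullv.

Definition module_iso (S T : vectType F)
    (rho : lieModule L S) (tau : lieModule L T) : Prop :=
  exists f : 'Hom(S, T), bijective f /\ forall x s, f (rho x s) = tau x (f s).

Section Submodule.
Variables (S : vectType F) (rho : lieModule L S) (T : {vspace S}).
Hypothesis modT : is_submodule rho T.

Let act (x : L) (t : subvs_of T) : subvs_of T := vsproj T (rho x (vsval t)).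

Let val_act x t : vsval (act x t) = rho x (vsval t).
Proof. by rewrite vsprojK // modT // subvsP. Qed.
Let act_linearl t : linear (act^~ t).
Proof. by move=> a x y; rewrite /act lact_linearl linearP. Qed.
Let act_linearr x : linear (act x).
Proof. by move=> a s t; rewrite /act linearP lact_linearr linearP. Qed.
Let act_lie x y t : act [lie x, y] t = act x (act y t) - act y (act x t).
Proof.
apply: val_inj; rewrite [LHS]val_act lact_lie.
by rewrite [RHS](linearB (vsval : subvs_of T -> S)) /= !val_act.
Qed.

Definition submodule : lieModule L (subvs_of T) :=
  LieModule act_linearl act_linearr act_lie.

End Submodule.

Definition lact_hom (S : vectType F) (rho : lieModule L S) (x : L) : 'End(S) :=
  hom_of (lact_linearr rho x).

Section Operators.
Variables (S : vectType F) (rho : lieModule L S).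

Lemma lact_hom_linear : linear (lact_hom rho).
Proof.
move=> a x y; apply/lfunP=> s.
by rewrite add_lfunE scale_lfunE !hom_ofE lact_linearl.
Qed.

Definition Ann_space : {vspace L} := lker (hom_of lact_hom_linear).

Lemma Ann_spaceP x : reflect (forall s, rho x s = 0) (x \in Ann_space).
Proof.
rewrite memv_ker hom_ofE.
apply: (iffP eqP) => [x0 s | x0].
  by rewrite -(hom_ofE (lact_linearr rho x)) [hom_of _]x0 zero_lfunE.
by apply/lfunP=> s; rewrite hom_ofE zero_lfunE.
Qed.

Lemma lact0r x : rho x 0 = 0.
Proof. by rewrite -(hom_ofE (lact_linearr rho x)) linear0. Qed.

Lemma Ann_ideal : is_ideal Ann_space.
Proof.
move=> x y /Ann_spaceP y0; apply/Ann_spaceP=> s.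
by rewrite lact_lie !y0 lact0r subr0.
Qed.

Definition Ann : lieIdeal L := LieIdeal Ann_ideal.

Definition comm_with (phi : 'End(S)) (x : L) : 'End(S) :=
  ((phi \o lact_hom rho x) - (lact_hom rho x \o phi))%VF.

Lemma comm_withE phi x s : comm_with phi x s = phi (rho x s) - rho x (phi s).
Proof. by rewrite add_lfunE opp_lfunE !comp_lfunE !hom_ofE. Qed.

Lemma comm_with_linear phi : linear (comm_with phi).
Proof.
move=> a x y; apply/lfunP=> s.
rewrite [RHS]add_lfunE scale_lfunE !comm_withE !lact_linearl linearP.
by rewrite scalerBr opprD addrACA.
Qed.

Lemma comm_linear : linear (fun phi => hom_of (comm_with_linear phi)).
Proof.
move=> a phi psi; apply/lfunP=> x; rewrite [RHS]add_lfunE scale_lfunE !hom_ofE.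
apply/lfunP=> s; rewrite [RHS]add_lfunE scale_lfunE !comm_withE.
rewrite !add_lfunE !scale_lfunE lact_linearr.
by rewrite scalerBr opprD addrACA.
Qed.

Definition End_L : {vspace 'End(S)} := lker (hom_of comm_linear).

Lemma End_LP (phi : 'End(S)) :
  reflect (forall x s, phi (rho x s) = rho x (phi s)) (phi \in End_L).
Proof.
rewrite memv_ker hom_ofE; apply: (iffP eqP) => [H x s | H].
  move/lfunP/(_ x)/lfunP/(_ s): H.
  by rewrite hom_ofE comm_withE !zero_lfunE => /eqP; rewrite subr_eq0 => /eqP.
apply/lfunP=> x; apply/lfunP=> s.
by rewrite hom_ofE comm_withE !zero_lfunE H subrr.
Qed.

End Operators.
End Modules.

(* S as a module over L / Ann_L(S); see Ann_moduleE. *)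
Section AnnModule.
Variables (F : fieldType) (L : lieAlgType F) (S : vectType F).
Variable rho : lieModule L S.

Let act (u : lieQuot (Ann rho)) (s : S) : S := rho (lrepr u) s.

Let act_pi x s : act (lpi (Ann rho) x) s = rho x s.
Proof.
have /Ann_spaceP/(_ s) : lrepr (lpi (Ann rho) x) - x \in Ann rho.
  by apply/vpi_eqP; rewrite [LHS]lreprK.
by rewrite -scaleN1r addrC lact_linearl scaleN1r addrC => /eqP; rewrite subr_eq0 => /eqP.
Qed.
Let act_linearl s : linear (act^~ s).
Proof. by move=> a u v; rewrite /act /lrepr linearP lact_linearl. Qed.
Let act_linearr u : linear (act u).
Proof. exact: lact_linearr. Qed.
Let act_lie u v s : act [lie u, v] s = act u (act v s) - act v (act u s).
Proof. by rewrite -[u]lreprK -[v]lreprK -lpi_morphism !act_pi lact_lie. Qed.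

Definition Ann_module : lieModule (lieQuot (Ann rho)) S :=
  LieModule act_linearl act_linearr act_lie.

Lemma Ann_moduleE x s : Ann_module (lpi (Ann rho) x) s = rho x s.
Proof. exact: act_pi. Qed.

End AnnModule.

(* The Chevalley-Eilenberg complex in degrees 0, 1, 2. The target of d1 is the
   space of all bilinear maps L x L -> S; d1 f is alternating (ce_d1xx), so its
   kernel is the same as for the corestriction to Hom(Lambda^2 L, S). *)
Section Cohomology.
Variables (F : fieldType) (L : lieAlgType F) (S : vectType F).
Variable rho : lieModule L S.

Definition ce_d0_fun (s : S) : 'Hom(L, S) := hom_of (lact_linearl rho s).

Lemma ce_d0_linear : linear ce_d0_fun.
Proof.
move=> a s t; apply/lfunP=> x.
by rewrite add_lfunE scale_lfunE !hom_ofE lact_linearr.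
Qed.

Definition ce_d0 : 'Hom(S, 'Hom(L, S)) := hom_of ce_d0_linear.

Lemma ce_d0E s x : ce_d0 s x = rho x s.
Proof. by rewrite !hom_ofE. Qed.

Let distr a (u u' v v' w w' : S) :
  (a *: u + u') - (a *: v + v') - (a *: w + w') =
  a *: (u - v - w) + (u' - v' - w').
Proof. by rewrite !scalerBr !opprD [in LHS](addrACA (a *: u)) [LHS]addrACA. Qed.

Definition ce_d1_fun (f : 'Hom(L, S)) (x y : L) : S :=
  rho x (f y) - rho y (f x) - f [lie x, y].

Lemma ce_d1_linear2 f x : linear (ce_d1_fun f x).
Proof.
move=> a y z; rewrite /ce_d1_fun lie_linearr !(linearP f).
by rewrite lact_linearr lact_linearl distr.
Qed.

Lemma ce_d1_linear1 f : linear (fun x => hom_of (ce_d1_linear2 f x)).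
Proof.
move=> a x z; apply/lfunP=> y; rewrite [RHS]add_lfunE scale_lfunE !hom_ofE.
rewrite /ce_d1_fun lie_linearl !(linearP f).
by rewrite lact_linearr lact_linearl distr.
Qed.

Lemma ce_d1_linear : linear (fun f => hom_of (ce_d1_linear1 f)).
Proof.
move=> a f g; apply/lfunP=> x; rewrite [RHS]add_lfunE scale_lfunE !hom_ofE.
apply/lfunP=> y; rewrite [RHS]add_lfunE scale_lfunE !hom_ofE.
by rewrite /ce_d1_fun !(add_lfunE, scale_lfunE) !lact_linearr distr.
Qed.

Definition ce_d1 : 'Hom('Hom(L, S), 'Hom(L, 'Hom(L, S))) := hom_of ce_d1_linear.

Lemma ce_d1E f x y : ce_d1 f x y = rho x (f y) - rho y (f x) - f [lie x, y].
Proof. by rewrite !hom_ofE. Qed.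

Lemma ce_d1xx f x : ce_d1 f x x = 0.
Proof. by rewrite ce_d1E lie_xx linear0 subr0 subrr. Qed.

Lemma ce_d1_d0 s : ce_d1 (ce_d0 s) = 0.
Proof.
apply/lfunP=> x; apply/lfunP=> y.
by rewrite ce_d1E !ce_d0E lact_lie subrr !zero_lfunE.
Qed.

(* H^1(L, S) = ker d1 / im d0, inside Hom(L, S) / im d0. *)
Definition H1 : {vspace vquot (limg ce_d0)} :=
  (vpi (limg ce_d0) @: lker ce_d1)%VS.

Lemma dim_H1 : (\dim H1 + \dim (limg ce_d0) = \dim (lker ce_d1))%N.
Proof.
rewrite addnC -(limg_ker_dim (vpi (limg ce_d0)) (lker ce_d1)) lker_vpi.
congr (\dim _ + _)%N; apply/esym/capv_idPr/subvP=> _ /memv_imgP[s _ ->].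
by rewrite memv_ker ce_d1_d0.
Qed.

End Cohomology.

Section ChiefFactors.
Variables (F : fieldType) (L : lieAlgType F).

(* L / I as an L-module via the adjoint action. *)
Section QuotientAdjoint.
Variable I : lieIdeal L.

Let act (x : L) (u : lieQuot I) : lieQuot I := [lie lpi I x, u].

Let act_linearl u : linear (act^~ u).
Proof. by move=> a x y; rewrite /act linearP lie_linearl. Qed.
Let act_linearr x : linear (act x).
Proof. exact: lie_linearr. Qed.
Let act_lie x y u : act [lie x, y] u = act x (act y u) - act y (act x u).
Proof.
rewrite /act lpi_morphism.
set X := lpi I x; set Y := lpi I y.
have /eqP := lie_jacobi X Y u.
rewrite (lieC u [lie X, Y]) subr_eq0 => /eqP <-.
by rewrite (lieC u X) lieNr.
Qed.

Definition quotient_adjoint : lieModule L (lieQuot I) :=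
  LieModule act_linearl act_linearr act_lie.

End QuotientAdjoint.

(* J / I as a subspace of L / I *)
Definition factor (I J : lieIdeal L) : {vspace lieQuot I} := (lpi I @: J)%VS.

Lemma factor_submodule (I J : lieIdeal L) :
  is_submodule (quotient_adjoint I) (factor I J).
Proof.
move=> x _ /memv_imgP[y Jy ->].
rewrite [lact _ _ _](_ : _ = [lie lpi I x, lpi I y]) // -lpi_morphism.
by rewrite memv_img // idealP.
Qed.

Definition factor_module (I J : lieIdeal L) : lieModule L (subvs_of (factor I J)) :=
  submodule (@factor_submodule I J).

Definition abelian_factor (I J : lieIdeal L) : Prop :=
  forall u v, u \in factor I J -> v \in factor I J -> [lie u, v] = 0.

(* L / I -> L / J, for I contained in J *)
Definition quotient_map (I J : lieIdeal L) (u : lieQuot I) : lieQuot J :=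
  lpi J (lrepr u).

Lemma quotient_mapE (I J : lieIdeal L) x : (I <= J)%VS ->
  quotient_map J (lpi I x) = lpi J x.
Proof.
move/subvP=> sIJ; apply/vpi_eqP/sIJ/vpi_eqP.
by rewrite [LHS]lreprK.
Qed.

(* 0 -> J / I -> L / I -> L / J -> 0 splits in the category of Lie algebras *)
Definition split_factor (I J : lieIdeal L) : Prop :=
  exists sigma : 'Hom(lieQuot J, lieQuot I),
    lie_morphism sigma /\ forall u, quotient_map J (sigma u) = u.

(* The ideals L_0, ..., L_n of the series are the values of chief_ideal at
   0, ..., n; the values beyond n are irrelevant. *)
Record chiefSeries := ChiefSeries {
  chief_length : nat;
  chief_ideal :> nat -> lieIdeal L;
  chief_bot : chief_ideal 0 = 0%VS :> {vspace L};
  chief_top : chief_ideal chief_length = fullv :> {vspace L};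
  chief_sub : forall j, (j < chief_length)%N ->
    (chief_ideal j <= chief_ideal j.+1)%VS;
  chief_minimal : forall j, (j < chief_length)%N ->
    minimal_ideal (factor (chief_ideal j) (chief_ideal j.+1))
}.

(* [L : S]_split, computed in the chief series C; the index j < n stands for
   the factor L_(j+1) / L_j. *)
Definition split_mult (C : chiefSeries) (S : vectType F) (rho : lieModule L S) :=
  #|[set j : 'I_(chief_length C) |
     `[< [/\ abelian_factor (C j) (C j.+1),
             module_iso (factor_module (C j) (C j.+1)) rho &
             split_factor (C j) (C j.+1)] >] ]|.

Lemma mem_factor (I J : lieIdeal L) x : (I <= J)%VS ->
  (lpi I x \in factor I J) = (x \in J).
Proof.
move/subvP=> sIJ; apply/idP/idP=> [/memv_imgP[y Jy /vpi_eqP/sIJ] | Jx].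
  by rewrite -{2}[x](subrK y) => Jxy; rewrite memvD.
exact: memv_img.
Qed.

Lemma chief_step (I : lieIdeal L) : I <> fullv :> {vspace L} ->
  exists J : lieIdeal L,
    [/\ (I <= J)%VS, (\dim I < \dim J)%N & minimal_ideal (factor I J)].
Proof.
move=> I'L.
pose P n := `[< exists J : lieIdeal L,
  [/\ (I <= J)%VS, J <> I :> {vspace L} & \dim J = n] >].
have exP : exists n, P n.
  have idL : is_ideal (fullv : {vspace L}) by move=> x y _; apply: memvf.
  exists (\dim (fullv : {vspace L})); apply/asboolP; exists (LieIdeal idL).
  by split=> //; [apply: subvf | move=> /esym].
case: (ex_minnP exP) => n /asboolP[J [sIJ J'I dimJ]] minJ; exists J.
split=> //.
  rewrite ltnNge; apply/negP=> leJI; apply: J'I.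
  by apply/esym/eqP; rewrite eqEdim sIJ.
split.
- move=> u v; rewrite -[u]lreprK -[v]lreprK -lpi_morphism !mem_factor //.
  exact: idealP.
- move=> J0; apply: J'I; apply/eqP; rewrite eqEsubv sIJ andbT.
  apply/subvP=> x; rewrite -(mem_factor x sIJ) J0 memv0 => /eqP x0.
  by rewrite -(lker_vpi I) memv_ker; apply/eqP.
move=> K idK sKJ; pose M := (lpi I @^-1: K)%VS.
have memM x : (x \in M) = (lpi I x \in K) by rewrite -memv_preim.
have idM : is_ideal M.
  by move=> x y; rewrite !memM lpi_morphism; apply: idK.
have sIM : (I <= M)%VS.
  apply/subvP=> x; rewrite memM -{1}(lker_vpi I) memv_ker => /eqP x0.
  by rewrite [lpi I x]x0 mem0v.
have sMJ : (M <= J)%VS.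
  by apply/subvP=> x; rewrite memM => /(subvP sKJ); rewrite mem_factor.
have [eMI | M'I] := eqVneq M I.
  left; apply/eqP; rewrite -subv0; apply/subvP=> u; rewrite -[u]lreprK -memM eMI.
  by rewrite -{1}(lker_vpi I) memv_ker memv0.
right; apply/eqP; rewrite eqEsubv sKJ; apply/subvP=> u.
have eMJ : M = J.
  apply/eqP; rewrite eqEdim sMJ dimJ minJ //; apply/asboolP.
  by exists (LieIdeal idM); split=> //; apply/eqP.
by rewrite -[u]lreprK mem_factor // -eMJ memM.
Qed.

Lemma chiefSeries_exists : inhabited chiefSeries.
Proof.
have id0 : is_ideal (0%VS : {vspace L}).
  by move=> x y; rewrite memv0 => /eqP->; rewrite lie0r mem0v.
suff H n (I : lieIdeal L) : (\dim (fullv : {vspace L}) <= \dim I + n)%N ->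
    exists m, exists c : nat -> lieIdeal L,
    [/\ c 0%N = I :> {vspace L}, c m = fullv :> {vspace L} &
        forall j, (j < m)%N -> (c j <= c j.+1)%VS /\
                               minimal_ideal (factor (c j) (c j.+1))].
  have [m [c [c0 cm H']]] := H _ (LieIdeal id0) (leq_addl _ _).
  by constructor; exists m c => // j /H'[].
elim: n I => [|n IHn] I leLI.
  exists 0%N, (fun=> I); split=> //.
  by apply/eqP; rewrite eqEdim subvf /= -[X in (_ <= X)%N]addn0.
have [eIL | I'L] := eqVneq (I : {vspace L}) fullv.
  by exists 0%N, (fun=> I).
have [J [sIJ ltIJ minJ]] := chief_step (elimN eqP I'L).
have [|m [c [c0 cm H']]] := IHn J.
  by apply: leq_trans leLI _; rewrite addnS -addSn leq_add2r.
have eJ : c 0%N = J by case: (c 0%N) (J) c0 => U idU [V idV] /= e; subst V;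
  congr LieIdeal; apply: Prop_irrelevance.
exists m.+1, (fun j => if j is k.+1 then c k else I); split=> // -[_|j].
  by rewrite eJ.
exact: H'.
Qed.

End ChiefFactors.

Arguments chiefSeries {F} L.

(* Main.v *)
Require Import Defs.
From HB Require Import structures.
From mathcomp Require Import all_boot all_order all_algebra.
From mathcomp Require Import mpoly ring.
From mathcomp Require boolp.

Set Implicit Arguments.
Unset Strict Implicit.
Unset Printing Implicit Defensive.

Import GRing.Theory.
Local Open Scope ring_scope.

(** Let Z(I) be the space of 1-cocycles of L with values in an irreducible module
S that vanish on I :&: Ann S, for an ideal I. Climbing one step I < J of a chief
series, the dimension of Z drops by dim End_L(S) if J / I is a split abelian
factor isomorphic to S, and does not change otherwise: a cocycle of Z(I) that is
not in Z(J) restricts to an equivariant isomorphism from J / I to S, and its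
kernel is a complement of J / I; conversely, projecting along a complement turns
an isomorphism from J / I to S into a cocycle. As Z(0) consists of all cocycles
([dim_cocycles]), the equality (iii) for S holds if and only if every cocycle
vanishing on Ann S is a coboundary ([dim_H1_split_mult]), that is, if and only if
the first cohomology of L / Ann S in S vanishes. This settles (ii) => (iii).

(i) => (ii): the last nonzero term A of the derived series of L / Ann S is an
abelian ideal acting nontrivially on S. In characteristic p the p-th power of
the action of an element of A commutes with L, so it is zero or bijective; if
it were zero for all elements, A would kill a nonzero submodule, that is, S.
Hence some a in A acts bijectively. A cocycle can be corrected by a coboundary
so that it vanishes at a; it then vanishes on A, and so everywhere
([abelian_ideal_acyclic]).

(iii) => (i): arguing by induction on dim L, one may assume that L is not
solvable but that all its proper quotients are. The last term M of the derived
series is then perfect and contained in every nonzero ideal, and the hypothesis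
says that every irreducible S with M S != 0 has H^1(L, S) = 0. By devissage,
modules without trivial M-subquotients then have no H^1, and it follows that a
module without M-invariants has no trivial M-subquotient at all
([no_invariants_no_trivial]). Dually, M S contains no nonzero M-invariant, for
every module S ([no_invariant_in_span]). In characteristic p this fails for
S = S^p(L), the p-th symmetric power of the adjoint module. The p-th powers of
elements of L are invariant. Moreover, for x in M, the derivation (ad x)^p is
inner, since M has no H^1, and is given by an element x' of M. If D denotes the
derivation ad x of the symmetric algebra, then for every w in L

   (D w)^p = w^(p-1) D^p w + D z     for some z in S^p(L)

([pth_power_derivation]), and w^(p-1) D^p w = w^(p-1) [x', w] lies in M S^p(L)
because M is perfect. So [x, w]^p is an invariant in M S^p(L), whence [x, w] = 0
for all x in M and w in L, which contradicts M = [M, M] != 0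
([least_perfect_ideal_zero]). *)

(** * Subspaces of a finite-dimensional space *)

Section Subspaces.
Variables (F : fieldType) (V : vectType F).

Lemma subspace_max (P : {vspace V} -> Prop) U0 : P U0 ->
  exists2 U, P U & forall W, P W -> (\dim W <= \dim U)%N.
Proof.
move=> PU0.
have exP : exists n, boolp.asbool (exists2 U, P U & \dim U = n).
  by exists (\dim U0); apply/boolp.asboolP; exists U0.
have ubP n : boolp.asbool (exists2 U, P U & \dim U = n) ->
    (n <= \dim (fullv : {vspace V}))%N.
  by move/boolp.asboolP=> [U _ <-]; apply: dimvS (subvf _).
case: (ex_maxnP exP ubP) => n /boolp.asboolP[U PU dimU] maxn.
exists U => // W PW; rewrite dimU; apply: maxn.
by apply/boolp.asboolP; exists W.
Qed.

Lemma subspace_min (P : {vspace V} -> Prop) U0 : P U0 ->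
  exists2 U, P U & forall W, P W -> (\dim U <= \dim W)%N.
Proof.
move=> PU0.
have exP : exists n, boolp.asbool (exists2 U, P U & \dim U = n).
  by exists (\dim U0); apply/boolp.asboolP; exists U0.
case: (ex_minnP exP) => n /boolp.asboolP[U PU dimU] minn.
exists U => // W PW; rewrite dimU; apply: minn.
by apply/boolp.asboolP; exists W.
Qed.

(** A predicate closed under linear combinations is membership in a subspace, namely
the largest one on which it holds. *)
Lemma subspace_of_pred (P : V -> Prop) :
    P 0 -> (forall a u v, P u -> P v -> P (a *: u + v)) ->
  exists U : {vspace V}, forall v, v \in U <-> P v.
Proof.
move=> P0 PD.
have [|U PU maxU] := @subspace_max (fun U => forall v, v \in U -> P v) 0%VS.
  by move=> v; rewrite memv0 => /eqP->.
exists U => v; split=> [|Pv]; first exact: PU.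
have : (U + <[v]> <= U)%VS.
  suff /eqP <- : U == (U + <[v]>)%VS by apply: subvv.
  rewrite eqEdim addvSl maxU // => w /memv_addP[u Uu [_ /vlineP[a ->] ->]].
  by rewrite addrC; apply: PD => //; apply: PU.
by rewrite subv_add -memvE => /andP[].
Qed.

Lemma exists_nonzero (U : {vspace V}) : U <> 0%VS -> exists2 u, u \in U & u != 0.
Proof.
by move=> nzU; exists (vpick U); rewrite ?memv_pick // vpick0; apply/eqP.
Qed.

End Subspaces.

(** * Modules and 1-cocycles *)

Section ModuleTheory.
Variables (F : fieldType) (L : lieAlgType F) (S : vectType F).
Variable rho : lieModule L S.
Implicit Types (x y : L) (s t : S).

Lemma lactDl x y s : rho (x + y) s = rho x s + rho y s.
Proof. by have := @lact_linearl _ _ _ rho s 1 x y; rewrite !scale1r. Qed.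
Lemma lact0l s : rho 0 s = 0.
Proof. by apply: (addrI (rho 0 s)); rewrite -lactDl !addr0. Qed.
Lemma lactZl a x s : rho (a *: x) s = a *: rho x s.
Proof. by rewrite -[a *: x]addr0 lact_linearl lact0l addr0. Qed.
Lemma lactNl x s : rho (- x) s = - rho x s.
Proof. by rewrite -scaleN1r lactZl scaleN1r. Qed.
Lemma lactDr x s t : rho x (s + t) = rho x s + rho x t.
Proof. by have := @lact_linearr _ _ _ rho x 1 s t; rewrite !scale1r. Qed.
Lemma lactZr a x s : rho x (a *: s) = a *: rho x s.
Proof. by rewrite -[a *: s]addr0 lact_linearr lact0r addr0. Qed.
Lemma lactNr x s : rho x (- s) = - rho x s.
Proof. by rewrite -scaleN1r lactZr scaleN1r. Qed.
Lemma lactBr x s t : rho x (s - t) = rho x s - rho x t.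
Proof. by rewrite lactDr lactNr. Qed.

Lemma lact_swap x y s : rho x (rho y s) = rho y (rho x s) + rho [lie x, y] s.
Proof. by rewrite lact_lie addrC subrK. Qed.

Definition cocycle (f : 'Hom(L, S)) : Prop :=
  forall x y, f [lie x, y] = rho x (f y) - rho y (f x).

Definition coboundary (f : 'Hom(L, S)) : Prop := exists s, forall x, f x = rho x s.

Definition acyclic : Prop := forall f, cocycle f -> coboundary f.

Lemma cocycleP f : f \in lker (ce_d1 rho) <-> cocycle f.
Proof.
rewrite memv_ker; split=> [/eqP f0 x y | Zf].
  apply/esym/eqP; rewrite -subr_eq0 -ce_d1E f0.
  by rewrite !zero_lfunE.
apply/eqP/lfunP=> x; apply/lfunP=> y.
by rewrite ce_d1E Zf subrr !zero_lfunE.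
Qed.

Lemma coboundaryP f : f \in limg (ce_d0 rho) <-> coboundary f.
Proof.
split=> [/memv_imgP[s _ ->] | [s fs]].
  by exists s => x; rewrite ce_d0E.
have ->: f = ce_d0 rho s by apply/lfunP=> x; rewrite ce_d0E fs.
exact: memv_img (memvf _).
Qed.

Lemma coboundary_cocycle f : coboundary f -> cocycle f.
Proof. by case=> s fs x y; rewrite !fs lact_lie. Qed.

Lemma H1_eq0P : H1 rho = 0%VS <-> acyclic.
Proof.
have sBZ : (limg (ce_d0 rho) <= lker (ce_d1 rho))%VS.
  by apply/subvP=> f /coboundaryP/coboundary_cocycle/cocycleP.
split=> [H0 f /cocycleP Zf | acyc].
  apply/coboundaryP; suff /eqP-> : limg (ce_d0 rho) == lker (ce_d1 rho) by [].
  by rewrite eqEdim sBZ -dim_H1 H0 dimv0 add0n /=.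
apply/eqP; rewrite -dimv_eq0 -(eqn_add2r (\dim (limg (ce_d0 rho)))) dim_H1 add0n.
apply/eqP; congr (\dim _); apply/eqP; rewrite eqEsubv sBZ andbT.
by apply/subvP=> f /cocycleP/acyc/coboundaryP.
Qed.

Lemma cocycleD f g : cocycle f -> cocycle g -> cocycle (f + g).
Proof.
move=> Zf Zg x y; rewrite !add_lfunE Zf Zg !lactDr opprD.
by rewrite -!addrA; congr (_ + _); rewrite addrCA.
Qed.

Lemma cocycleN f : cocycle f -> cocycle (- f).
Proof. by move=> Zf x y; rewrite !opp_lfunE Zf !lactNr opprB opprK addrC. Qed.

Lemma irreducible_full T : irreducible rho -> is_submodule rho T -> T <> 0%VS ->
  T = fullv.
Proof. by move=> [_ irrS] /irrS[]. Qed.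

Lemma irreducible_mem T s t : irreducible rho -> is_submodule rho T ->
  s \in T -> s != 0 -> t \in T.
Proof.
move=> irrS subT Ts nzs; rewrite (irreducible_full irrS subT) ?memvf //.
by move=> T0; rewrite T0 memv0 (negPf nzs) in Ts.
Qed.

End ModuleTheory.

(** * Abelian ideals acting nontrivially *)

Section AbelianIdeal.
Variables (F : fieldType) (p : nat) (charF : p \in [pchar F]).
Variables (L : lieAlgType F) (S : vectType F) (rho : lieModule L S).
Variable A : {vspace L}.
Hypotheses (idA : is_ideal A) (abA : forall a b, a \in A -> b \in A -> [lie a, b] = 0).
Hypothesis irrS : irreducible rho.

Let lactC a b s : a \in A -> b \in A -> rho a (rho b s) = rho b (rho a s).
Proof. by move=> Aa Ab; rewrite lact_swap abA // lact0l addr0. Qed.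

Let iter_lactC n a b s : a \in A -> b \in A ->
  iter n (rho a) (rho b s) = rho b (iter n (rho a) s).
Proof. by move=> Aa Ab; elim: n => //= n ->; apply: lactC. Qed.

(** As A is abelian, [a, x] commutes with a, so that a^n x = x a^n + n [a, x] a^(n-1)
as operators. *)
Let iter_lact_swap n a x s : a \in A ->
  iter n.+1 (rho a) (rho x s) =
  rho x (iter n.+1 (rho a) s) + rho [lie a, x] (iter n (rho a) s) *+ n.+1.
Proof.
move=> Aa; have Aax : [lie a, x] \in A by rewrite lieC memvN; apply: idA.
elim: n => [|n IHn]; first by rewrite /= lact_swap.
rewrite iterS IHn lactDr lact_swap -addrA; congr (_ + _).
rewrite -(hom_ofE (lact_linearr rho a)) linearMn /= hom_ofE.
by rewrite lactC // -iterS mulrS.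
Qed.

Let natp0 (s : S) : s *+ p = 0.
Proof. by rewrite -scaler_nat (pcharf0 charF) scale0r. Qed.

Let p_gt0 : (0 < p)%N. Proof. exact/prime_gt0/(pcharf_prime charF). Qed.

(** By [iter_lact_swap] the p-th power of rho a commutes with L, so its kernel is a
submodule. *)
Let nilpotent_or_injective a : a \in A ->
  (forall s, iter p (rho a) s = 0) \/ (forall s, rho a s = 0 -> s = 0).
Proof.
move=> Aa; have [] := @subspace_of_pred _ _ (fun s => iter p (rho a) s = 0).
- by elim: (p) => //= n ->; apply: lact0r.
- move=> c u v u0 v0.
  have ->: iter p (rho a) (c *: u + v) =
      c *: iter p (rho a) u + iter p (rho a) v.
    by elim: (p) => //= n ->; rewrite lact_linearr.
  by rewrite u0 v0 scaler0 addr0.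
move=> K memK.
have subK : is_submodule rho K.
  move=> x s /memK s0; apply/memK; rewrite -(prednK p_gt0) iter_lact_swap //.
  by rewrite prednK // natp0 addr0 s0 lact0r.
case: (irrS.2 _ subK) => defK; last by left=> s; apply/memK; rewrite defK memvf.
right=> s s0; apply/eqP; rewrite -memv0 -defK; apply/memK.
by rewrite -(prednK p_gt0) iterSr s0; elim: (p.-1) => //= n ->; apply: lact0r.
Qed.

(** The operators rho a commute: the last nonzero iterate of rho a on a vector killed
by other elements of A is still killed by them. *)
Let common_kernel (r : seq L) : {subset r <= A} ->
    (forall a, a \in A -> forall s, iter p (rho a) s = 0) ->
  exists2 s, s != 0 & forall a, a \in r -> rho a s = 0.
Proof.
move=> + nilA; elim: r => [|a r IHr] sAr.
  by have [s _ nzs] := exists_nonzero irrS.1; exists s.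
have Aa : a \in A by apply: sAr; rewrite mem_head.
have [|s nzs s0] := IHr; first by move=> b rb; apply: sAr; rewrite inE rb orbT.
have exn : exists n, iter n (rho a) s == 0 by exists p; rewrite nilA.
case: (ex_minnP exn) => -[|n] /eqP an0 minn; first by rewrite -an0 eqxx in nzs.
exists (iter n (rho a) s).
  by apply/negP=> /minn; rewrite ltnn.
move=> b; rewrite inE => /predU1P[-> // | rb].
rewrite -iter_lactC ?s0 //; last by apply: sAr; rewrite inE rb orbT.
by elim: (n) => //= k ->; apply: lact0r.
Qed.

(** If all elements of A acted nilpotently, the vectors killed by A would form a
nonzero submodule, hence all of S. *)
Let exists_injective : ~ (A <= Ann_space rho)%VS ->
  exists2 a, a \in A & forall s, rho a s = 0 -> s = 0.
Proof.
move=> A'Ann; apply: boolp.contrapT => no_inj; apply: A'Ann.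
have nilA a : a \in A -> forall s, iter p (rho a) s = 0.
  move=> Aa; case: (nilpotent_or_injective Aa) => // inja.
  by case: no_inj; exists a.
have sAA : {subset vbasis A <= A} by move=> a; apply: vbasis_mem.
have [s nzs s0] := common_kernel sAA nilA.
have [] := @subspace_of_pred _ _ (fun s => forall a, a \in A -> rho a s = 0).
- by move=> a _; apply: lact0r.
- by move=> c u v u0 v0 a Aa; rewrite lact_linearr u0 // v0 // scaler0 addr0.
move=> K memK.
have subK : is_submodule rho K.
  move=> x t /memK t0; apply/memK=> a Aa.
  rewrite lact_swap t0 // lact0r add0r t0 //.
  by rewrite lieC memvN; apply: idA.
have Ks : s \in K.
  apply/memK=> a Aa; rewrite (coord_vbasis Aa).
  apply: (big_ind (fun a => rho a s = 0)); first exact: lact0l.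
    by move=> b c b0 c0; rewrite lactDl b0 c0 addr0.
  by move=> i _; rewrite lactZl s0 ?scaler0 // mem_nth ?size_tuple.
apply/subvP=> a Aa; apply/Ann_spaceP=> t.
exact: (memK t).1 (irreducible_mem t irrS subK Ks nzs) a Aa.
Qed.

(** Let g be the cocycle f corrected by a coboundary so that g a = 0, where a acts
bijectively. Then g [a, x] = a g(x) for all x. As a centralizes A, this gives
g = 0 on A; as [a, x] lies in A, it then gives g = 0. *)
Lemma abelian_ideal_acyclic : ~ (A <= Ann_space rho)%VS -> acyclic rho.
Proof.
case/exists_injective=> a Aa inja f Zf.
have [s fs] : exists s, f a = rho a s.
  have : f a \in limg (lact_hom rho a).
    suff -> : limg (lact_hom rho a) = fullv by apply: memvf.
    apply/eqP; rewrite eqEdim subvf limg_dim_eq /= ?leqnn //.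
    apply/eqP; rewrite capfv -subv0; apply/subvP=> s; rewrite memv_ker hom_ofE.
    by move/eqP/inja->; rewrite mem0v.
  by case/memv_imgP=> s _ ->; exists s; rewrite hom_ofE.
exists s; pose g := f - ce_d0 rho s.
have Zg : cocycle rho g.
  apply: cocycleD => //; apply: cocycleN; apply: coboundary_cocycle.
  by exists s => x; rewrite ce_d0E.
have ga : g a = 0 by rewrite add_lfunE opp_lfunE ce_d0E fs subrr.
have g_adE x : g [lie a, x] = rho a (g x) by rewrite Zg ga lact0r subr0.
have gA b : b \in A -> g b = 0.
  by move=> Ab; apply: inja; rewrite -g_adE abA // linear0.
move=> x; apply/eqP; rewrite -subr_eq0 -ce_d0E; apply/eqP.
have <-: g x = f x - ce_d0 rho s x by rewrite add_lfunE opp_lfunE.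
by apply: inja; rewrite -g_adE gA // lieC memvN idA.
Qed.

End AbelianIdeal.

(** * Cocycles along a chief series *)

Section VanishingCocycles.
Variables (F : fieldType) (L : lieAlgType F) (S : vectType F).
Variable rho : lieModule L S.
Implicit Types I J : lieIdeal L.

Fact restriction_linear (U : {vspace L}) :
  linear (fun f : 'Hom(L, S) => (f \o projv U)%VF).
Proof.
move=> a f g; apply/lfunP=> x.
by rewrite add_lfunE scale_lfunE !comp_lfunE add_lfunE scale_lfunE.
Qed.

Definition vanishing_cocycles (U : {vspace L}) : {vspace 'Hom(L, S)} :=
  (lker (ce_d1 rho) :&: lker (hom_of (restriction_linear (U :&: Ann_space rho))))%VS.

Lemma vanishing_cocyclesP U f : f \in vanishing_cocycles U <->
  cocycle rho f /\ forall x, x \in U -> x \in Ann_space rho -> f x = 0.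
Proof.
rewrite memv_cap; split=> [/andP[/cocycleP Zf] | [/cocycleP -> /= f0]].
  rewrite memv_ker hom_ofE => /eqP/lfunP f0; split=> // x Ux Ax.
  by have := f0 x; rewrite comp_lfunE projv_id ?zero_lfunE // memv_cap Ux.
rewrite memv_ker hom_ofE; apply/eqP/lfunP=> x; rewrite comp_lfunE zero_lfunE.
by have := memv_proj (U :&: Ann_space rho)%VS x; rewrite memv_cap => /andP[/f0].
Qed.

Lemma vanishing_cocyclesS (U V : {vspace L}) : (U <= V)%VS ->
  (vanishing_cocycles V <= vanishing_cocycles U)%VS.
Proof.
move/subvP=> sUV; apply/subvP=> f /vanishing_cocyclesP[Zf f0].
by apply/vanishing_cocyclesP; split=> // x Ux; apply/f0/sUV.
Qed.

(** Given one cocycle f0 that induces an isomorphism from J / I to S, every f in Z(I)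
agrees on J with psi \o f0 for a unique psi in End_L(S), since f and f0 are
equivariant on J. So Z(I) is the direct sum of Z(J) and End_L(S) \o f0. *)
Lemma dim_vanishing_step I J (f0 : 'Hom(L, S)) :
    (I <= J)%VS -> (J <= Ann_space rho)%VS -> cocycle rho f0 ->
    (forall x, x \in J -> f0 x = 0 <-> x \in I) ->
    (forall s, exists2 x, x \in J & f0 x = s) ->
  \dim (vanishing_cocycles I) = (\dim (vanishing_cocycles J) + \dim (End_L rho))%N.
Proof.
move=> /subvP sIJ /subvP sJA Zf0 f0K f0_surj.
have actJ j s : j \in J -> rho j s = 0 by move/sJA/Ann_spaceP.
have comp_lin : linear (fun psi : 'End(S) => (psi \o f0)%VF).
  move=> a f g; apply/lfunP=> x.
  by rewrite add_lfunE scale_lfunE !comp_lfunE add_lfunE scale_lfunE.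
have compE psi x : hom_of comp_lin psi x = psi (f0 x).
  by rewrite hom_ofE comp_lfunE.
have inj_comp psi : (forall x, x \in J -> hom_of comp_lin psi x = 0) -> psi = 0.
  move=> psi0; apply/lfunP=> s; have [x Jx <-] := f0_surj s.
  by rewrite -compE psi0 // zero_lfunE.
have dimE : \dim (hom_of comp_lin @: End_L rho) = \dim (End_L rho).
  apply: limg_dim_eq; apply/eqP; rewrite -subv0; apply/subvP=> psi.
  rewrite memv_cap memv_ker => /andP[_ /eqP psi0].
  by rewrite (inj_comp psi) ?mem0v // => x _; rewrite psi0 zero_lfunE.
rewrite -dimE -dimv_disjoint_sum; last first.
  apply/eqP; rewrite -subv0; apply/subvP=> g; rewrite memv_cap.
  case/andP=> /vanishing_cocyclesP[_ gJ0] /memv_imgP[psi _ defg].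
  rewrite defg (inj_comp psi) ?linear0 ?mem0v // => x Jx.
  by rewrite -defg gJ0 // sJA.
congr (\dim _); apply/eqP; rewrite eqEsubv; apply/andP; split; last first.
  rewrite subv_add vanishing_cocyclesS; last exact/subvP.
  apply/subvP=> _ /memv_imgP[psi /End_LP psiL ->].
  apply/vanishing_cocyclesP; split=> [x y | x Ix _]; rewrite !compE.
    by rewrite Zf0 linearB /= !psiL.
  by rewrite (f0K x (sIJ x Ix)).2 // linear0.
apply/subvP=> f /vanishing_cocyclesP[Zf fI0].
(* a linear section tau of f0, with values in J *)
pose tau : 'Hom(S, L) := ((f0 \o projv J)^-1)%VF.
have f0tau s : f0 (projv J (tau s)) = s.
  rewrite -comp_lfunE limg_lfunVK //; have [x Jx <-] := f0_surj s.
  by apply/memv_imgP; exists x; rewrite ?memvf // comp_lfunE projv_id.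
pose psi : 'End(S) := (f \o (projv J \o tau))%VF.
have psiE x : x \in J -> psi (f0 x) = f x.
  move=> Jx; rewrite !comp_lfunE; set y := projv J _.
  have Jy : y \in J by apply: memv_proj.
  have Iyx : y - x \in I.
    by apply/f0K; rewrite ?memvB // linearB /= f0tau subrr.
  by apply/eqP; rewrite -subr_eq0 -(linearB f) /= fI0 //; apply/sJA/sIJ.
have psiL : psi \in End_L rho.
  apply/End_LP=> x s; have [y Jy <-] := f0_surj s.
  have Jxy : [lie x, y] \in J by apply: idealP.
  have f0xy : rho x (f0 y) = f0 [lie x, y] by rewrite Zf0 (actJ y) // subr0.
  by rewrite f0xy !psiE // Zf (actJ y) // subr0.
rewrite -(subrK (hom_of comp_lin psi) f) memv_add ?memv_img //.
apply/vanishing_cocyclesP; split=> [|x Jx _]; last first.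
  by rewrite add_lfunE opp_lfunE compE psiE ?subrr.
apply: cocycleD => //; apply: cocycleN => x y; rewrite !compE.
by rewrite Zf0 linearB /= !(End_LP rho psi psiL).
Qed.

Definition split_copy I J : Prop :=
  [/\ abelian_factor I J, module_iso (factor_module I J) rho & split_factor I J].

Lemma factorP I J (u : lieQuot I) :
  u \in factor I J -> exists2 x, x \in J & u = lpi I x.
Proof. by case/memv_imgP=> x Jx ->; exists x. Qed.

Lemma lpi_eq0 I x : lpi I x = 0 <-> x \in I.
Proof. by rewrite -(lker_vpi I) memv_ker; split=> [-> // | /eqP]. Qed.

(** Let g be an isomorphism from J / I to S and sigma a splitting. The ideal J acts
trivially on the abelian factor J / I, so J <= Ann S. The cocycle f0 sends x to
the image under g of x - sigma x, which is the component of x in J / I. *)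
Lemma split_copy_cocycle I J : (I <= J)%VS -> split_copy I J ->
  (J <= Ann_space rho)%VS /\ exists f0 : 'Hom(L, S),
   [/\ cocycle rho f0, forall x, x \in J -> f0 x = 0 <-> x \in I &
       forall s, exists2 x, x \in J & f0 x = s].
Proof.
move=> sIJ [abIJ [g [[g' gK g'K] gL]] [sigma [sigmaL sigmaK]]].
have val_actE x (u : subvs_of (factor I J)) :
    vsval (factor_module I J x u) = [lie lpi I x, vsval u].
  rewrite [LHS]vsprojK //; have := factor_submodule x (subvsP u); exact.
have sJA : (J <= Ann_space rho)%VS.
  apply/subvP=> x Jx; apply/Ann_spaceP=> s; rewrite -(g'K s) -gL.
  rewrite (_ : factor_module _ _ _ _ = 0) ?linear0 //; apply: val_inj.
  rewrite /= val_actE abIJ ?subvsP ?linear0 //; exact: memv_img.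
split=> //.
have d_lin : linear (fun x => lpi I x - sigma (lpi J x)).
  by move=> a x y; rewrite !(linearP (lpi _)) (linearP sigma) scalerBr opprD addrACA.
pose d := hom_of d_lin.
have dE x : d x = lpi I x - sigma (lpi J x) by rewrite hom_ofE.
have qmapB u v : quotient_map J (u - v) = quotient_map J u - quotient_map J v :> lieQuot J.
  by rewrite /quotient_map /lrepr !linearB.
have dJ x : d x \in factor I J.
  rewrite dE -[_ - _]lreprK mem_factor //; apply/lpi_eq0.
  by rewrite -[lpi J _]/(quotient_map J _) qmapB sigmaK quotient_mapE // subrr.
pose f0 : 'Hom(L, S) := (g \o (linfun (vsproj (factor I J)) \o d))%VF.
have f0E x : f0 x = g (vsproj (factor I J) (d x)) by rewrite !comp_lfunE lfunE.
have dJE x : x \in J -> d x = lpi I x.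
  by move=> Jx; rewrite dE (lpi_eq0 J x).2 // linear0 subr0.
have dlie x y : d [lie x, y] = [lie lpi I x, d y] - [lie lpi I y, d x].
  have dsig z : lpi I z = d z + sigma (lpi J z) by rewrite dE subrK.
  have dd u v : [lie d u, d v] = 0 by apply: abIJ; apply: dJ.
  rewrite dE !lpi_morphism sigmaL !dsig !lieDl !lieDr !dd !add0r.
  by rewrite addrA addrK (lieC _ (d x)) opprK addrC.
exists f0; split=> [x y | x Jx | s].
- rewrite !f0E -!gL -linearB; congr (g _); apply: val_inj.
  rewrite [RHS](linearB (vsval : subvs_of (factor I J) -> _)) /= !val_actE.
  by rewrite !vsprojK ?dJ.
- rewrite f0E dJE // -lpi_eq0; split=> [/(congr1 g') | ->]; last by rewrite !linear0.
  rewrite gK => e; have g0 : g' 0 = 0 by rewrite -(linear0 g) gK.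
  rewrite -(@vsprojK _ _ (factor I J) (lpi I x)) ?memv_img // e g0.
  by rewrite linear0.
- have [x Jx ux] := factorP (subvsP (g' s)); exists x => //.
  by rewrite f0E dJE // -ux vsvalK g'K.
Qed.

End VanishingCocycles.

Section ChiefSeriesCount.
Variables (F : fieldType) (L : lieAlgType F) (S : vectType F).
Variable rho : lieModule L S.
Hypothesis irrS : irreducible rho.
Implicit Types I J : lieIdeal L.

Lemma minimal_factorP I J (K : {vspace L}) : minimal_ideal (factor I J) ->
  (I <= K)%VS -> (K <= J)%VS -> is_ideal K -> K = I \/ K = J.
Proof.
move=> [_ _ minJ] sIK sKJ idK; pose LK := LieIdeal idK.
have sIJ := subv_trans sIK sKJ.
have [x u /factorP[y Ky ->] | | K0 | KJ] := minJ (factor I LK).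
- rewrite -[x]lreprK -lpi_morphism; apply: memv_img; exact: (idK _ y Ky).
- exact: limgS.
- left; apply/eqP; rewrite eqEsubv sIK andbT; apply/subvP=> x.
  by rewrite -(mem_factor (J := LK) _ sIK) K0 memv0 => /eqP/lpi_eq0.
- right; apply/eqP; rewrite eqEsubv sKJ; apply/subvP=> x.
  by rewrite -(mem_factor x sIJ) -KJ mem_factor.
Qed.

(** Here f induces an equivariant map from JA = J :&: Ann S onto S. By minimality of
J / I, the elements of JA killed by f lie in I, and J = I + JA; this puts J inside
Ann S, and f induces an isomorphism from J / I to S. The kernel of a cocycle is a
subalgebra, and that of f is a complement of J modulo I. *)
Lemma detect_split_copy I J (f : 'Hom(L, S)) : (I <= J)%VS ->
    minimal_ideal (factor I J) ->
    f \in vanishing_cocycles rho I -> f \notin vanishing_cocycles rho J ->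
  split_copy rho I J.
Proof.
move=> sIJ minJ /vanishing_cocyclesP[Zf fI] f'J.
have [j0 [Jj0 Aj0 nz_j0]] : exists j0, [/\ j0 \in J, j0 \in Ann_space rho & f j0 != 0].
  apply: boolp.contrapT => no_j0; case/negP: f'J; apply/vanishing_cocyclesP.
  split=> // x Jx Ax; apply/eqP/negbNE/negP=> nz; case: no_j0; by exists x.
pose JA := (J :&: Ann_space rho)%VS.
have idJA : is_ideal JA.
  move=> x y; rewrite !memv_cap => /andP[Jy Ay].
  by rewrite idealP //= Ann_ideal.
have actA x s : x \in Ann_space rho -> rho x s = 0 by move/Ann_spaceP.
have f_lieA x y : y \in Ann_space rho -> f [lie x, y] = rho x (f y).
  by move=> Ay; rewrite Zf (actA y) // subr0.
have f_surj s : exists2 x, x \in JA & f x = s.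
  have subT : is_submodule rho (f @: JA).
    move=> x _ /memv_imgP[y JAy ->]; apply/memv_imgP; exists [lie x, y].
      exact: idJA.
    by rewrite f_lieA //; move: JAy; rewrite memv_cap => /andP[].
  have : s \in (f @: JA)%VS.
    apply: (irreducible_mem s irrS subT) nz_j0; apply: memv_img.
    by rewrite memv_cap Jj0.
  by case/memv_imgP=> x JAx ->; exists x.
have sum_ideal (K : {vspace L}) : is_ideal K -> is_ideal (I + K).
  move=> idK x _ /memv_addP[u Iu [v Kv ->]]; rewrite lieDr memv_add //.
    exact: idealP.
  exact: idK.
have defJ : (I + JA)%VS = J.
  have [|||defI|//] := @minimal_factorP I J (I + JA)%VS minJ.
  - exact: addvSl.
  - by rewrite subv_add sIJ capvSl.
  - exact: sum_ideal.
  case/negP: nz_j0; apply/eqP/fI => //.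
  by rewrite -defI -[j0]add0r memv_add ?mem0v // memv_cap Jj0.
pose K := (JA :&: lker f)%VS.
have memK x : (x \in K) = [&& x \in J, x \in Ann_space rho & f x == 0].
  by rewrite !memv_cap memv_ker andbA.
have idK : is_ideal K.
  move=> x y; rewrite !memK => /and3P[Jy Ay /eqP fy].
  by rewrite idealP //= Ann_ideal //= f_lieA // fy lact0r.
have sKI : (K <= I)%VS.
  have [|||<-|defJ'] := @minimal_factorP I J (I + K)%VS minJ.
  - exact: addvSl.
  - by rewrite subv_add sIJ (subv_trans (capvSl _ _) (capvSl _ _)).
  - exact: sum_ideal.
  - exact: addvSr.
  have: j0 \in (I + K)%VS by rewrite defJ'.
  case/memv_addP=> i Ii [k]; rewrite memK => /and3P[Jk Ak /eqP fk] def_j0.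
  case/negP: nz_j0; rewrite def_j0 linearD /= fk addr0 fI //.
  by rewrite -[i](addrK k) -def_j0 memvB.
have sIA : (I <= Ann_space rho)%VS.
  apply/subvP=> i Ii; apply/Ann_spaceP=> s; have [j] := f_surj s.
  rewrite memv_cap => /andP[Jj Aj] <-; rewrite -f_lieA //.
  by apply: fI; [rewrite lieC memvN; apply: idealP | apply: Ann_ideal].
have sJA : (J <= Ann_space rho)%VS by rewrite -defJ subv_add sIA capvSr.
have fK x : x \in J -> f x = 0 <-> x \in I.
  move=> Jx; split=> [fx | Ix]; last by apply: fI => //; apply: (subvP sIA).
  by apply: (subvP sKI); rewrite memK Jx fx eqxx (subvP sJA).
have fI0 x : x \in I -> f x = 0 by move=> Ix; apply/fK => //; apply: (subvP sIJ).
split.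
- move=> _ _ /factorP[x Jx ->] /factorP[y Jy ->].
  rewrite -lpi_morphism; apply/lpi_eq0/fK; first exact: idealP.
  by rewrite f_lieA ?(subvP sJA) // actA // (subvP sJA).
- pose fbar : 'Hom(lieQuot I, S) := (f \o linfun (@vrepr _ _ I))%VF.
  have fbarE x : fbar (lpi I x) = f x.
    rewrite comp_lfunE lfunE /=; apply/eqP; rewrite -subr_eq0 -(linearB f) /=.
    by rewrite fI0 //; apply/lpi_eq0; rewrite linearB /= [lpi I (vrepr _)]vreprK subrr.
  pose g : 'Hom(subvs_of (factor I J), S) := (fbar \o linfun vsval)%VF.
  have gE u : g u = fbar (vsval u) by rewrite comp_lfunE [linfun _ u]lfunE.
  have g_surj s : s \in limg g.
    have [x JAx <-] := f_surj s.
    have Jx : x \in J by move: JAx; rewrite memv_cap => /andP[].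
    apply/memv_imgP; exists (vsproj (factor I J) (lpi I x)); first exact: memvf.
    by rewrite gE vsprojK ?memv_img // fbarE.
  have g_inj : lker g == 0%VS.
    rewrite -subv0; apply/subvP=> u; rewrite memv_ker gE memv0.
    have [x Jx ux] := factorP (subvsP u).
    rewrite ux fbarE => /eqP/fK-/(_ Jx)/lpi_eq0 x0.
    apply/eqP/val_inj; rewrite [LHS]ux x0.
    by rewrite [RHS](linear0 (vsval : subvs_of (factor I J) -> _)).
  exists g; split.
    exists (g^-1)%VF => [u|s]; first by rewrite lker0_lfunK.
    by rewrite limg_lfunVK.
  move=> x u; rewrite !gE [vsval (factor_module _ _ _ _)]vsprojK; last first.
    by have := factor_submodule x (subvsP u); exact.
  have [y Jy ->] := factorP (subvsP u).
  rewrite [lact _ _ _](_ : _ = lpi I [lie x, y]); last by rewrite lpi_morphism.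
  by rewrite !fbarE f_lieA // (subvP sJA).
- (* the kernel of f is a complement of J / I; sigma projects onto it along J *)
  pose tau : 'Hom(S, L) := ((f \o projv J)^-1)%VF.
  pose h : 'Hom(L, L) := (\1 - (projv J \o (tau \o f)))%VF.
  have ftau s : f (projv J (tau s)) = s.
    rewrite -comp_lfunE limg_lfunVK //; have [x] := f_surj s.
    rewrite memv_cap => /andP[Jx _] <-.
    by apply/memv_imgP; exists x; rewrite ?memvf // comp_lfunE projv_id.
  have hE x : h x = x - projv J (tau (f x)).
    by rewrite add_lfunE id_lfunE opp_lfunE !comp_lfunE.
  have fh x : f (h x) = 0 by rewrite hE linearB /= ftau subrr.
  have hJ x : x - h x \in J by rewrite hE subKr memv_proj.
  have hJI x : x \in J -> h x \in I.
    by move=> Jx; apply/fK => //; rewrite hE memvB // memv_proj.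
  pose sigma : 'Hom(lieQuot J, lieQuot I) := (lpi I \o (h \o linfun (@vrepr _ _ J)))%VF.
  have sigmaE x : sigma (lpi J x) = lpi I (h x).
    rewrite !comp_lfunE (lfunE (@vrepr _ _ J)); apply/eqP.
    rewrite -subr_eq0 -(linearB (lpi I)) /=.
    apply/eqP/lpi_eq0; rewrite -linearB; apply: hJI.
    by apply/lpi_eq0; rewrite linearB /= [lpi J (vrepr _)]vreprK subrr.
  have hK x : f x = 0 -> h x = x by move=> fx; rewrite hE fx !linear0 addr0.
  exists sigma; split=> [u v | u]; rewrite -[u]lreprK; last first.
    rewrite sigmaE quotient_mapE //; apply/vpi_eqP.
    by rewrite -opprB memvN.
  rewrite -[v]lreprK -lpi_morphism !sigmaE -lpi_morphism.
  set x := lrepr u; set y := lrepr v.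
  rewrite -[[lie h x, h y]]hK; last by rewrite Zf !fh !lact0r subrr.
  rewrite -(sigmaE [lie x, y]) -(sigmaE [lie h x, h y]); congr (sigma _).
  by apply: vpi_lie; apply/vpi_eqP.
Qed.

Lemma dim_vanishing_factor I J : (I <= J)%VS -> minimal_ideal (factor I J) ->
  \dim (vanishing_cocycles rho I) =
  (\dim (vanishing_cocycles rho J)
   + \dim (End_L rho) * boolp.asbool (split_copy rho I J))%N.
Proof.
move=> sIJ minJ; case: boolp.asboolP => [split_copyJ | not_split].
  have [sJA [f0 [Zf0 f0K f0_surj]]] := split_copy_cocycle sIJ split_copyJ.
  by rewrite muln1; apply: (dim_vanishing_step sIJ sJA Zf0).
rewrite muln0 addn0; congr (\dim _); apply/eqP; rewrite eqEsubv.
rewrite (vanishing_cocyclesS rho sIJ) andbT; apply/subvP=> f If.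
by apply: contra_notT not_split; apply: detect_split_copy.
Qed.

Lemma dim_cocycles (C : chiefSeries L) :
  \dim (lker (ce_d1 rho)) =
  (\dim (vanishing_cocycles rho fullv) + \dim (End_L rho) * split_mult C rho)%N.
Proof.
pose c j : nat := boolp.asbool (split_copy rho (C j) (C j.+1)).
have climb m : (m <= chief_length C)%N ->
    \dim (vanishing_cocycles rho (C 0%N)) =
    (\dim (vanishing_cocycles rho (C m)) + \dim (End_L rho) * \sum_(j < m) c j)%N.
  elim: m => [|m IHm] lemn; first by rewrite big_ord0 muln0 addn0.
  rewrite (IHm (ltnW lemn)).
  rewrite (dim_vanishing_factor (chief_sub lemn) (chief_minimal lemn)) -/(c m).
  by rewrite big_ord_recr mulnDr -addnA [X in (_ + X)%N]addnC.
have -> : split_mult C rho = (\sum_(j < chief_length C) c j)%N.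
  by rewrite /split_mult -sum1dep_card big_mkcond.
rewrite -(chief_top C) -climb //; congr (\dim _).
apply/vspaceP=> f; apply/idP/idP=> [/cocycleP Zf | /vanishing_cocyclesP[/cocycleP]//].
apply/vanishing_cocyclesP; split=> // x.
by rewrite chief_bot memv0 => /eqP-> _; rewrite linear0.
Qed.

(** This is acyclicity of S over L / Ann S, read on L so that it can be compared
with the spaces Z(I) and transported along quotients of L. *)
Definition Ann_acyclic : Prop := forall f : 'Hom(L, S), cocycle rho f ->
  (forall x, x \in Ann_space rho -> f x = 0) -> coboundary rho f.

Lemma coboundaries_vanish :
  (limg (ce_d0 rho) <= vanishing_cocycles rho fullv)%VS.
Proof.
apply/subvP=> f /coboundaryP Bf; apply/vanishing_cocyclesP.
split=> [|x _ /Ann_spaceP x0]; first exact: coboundary_cocycle.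
by have [s ->] := Bf.
Qed.

Lemma Ann_acyclicP : Ann_acyclic <-> vanishing_cocycles rho fullv = limg (ce_d0 rho).
Proof.
have sB := coboundaries_vanish.
split=> [acyc | defB f Zf f0].
  apply/eqP; rewrite eqEsubv sB andbT; apply/subvP=> f /vanishing_cocyclesP[Zf f0].
  by apply/coboundaryP/acyc => // x Ax; apply: f0 => //; apply: memvf.
by apply/coboundaryP; rewrite -defB; apply/vanishing_cocyclesP; split=> // x _; apply: f0.
Qed.

Lemma Ann_acyclic_of_module : acyclic (Ann_module rho) -> Ann_acyclic.
Proof.
move=> acyc f Zf f0.
pose fbar : 'Hom(lieQuot (Ann rho), S) := (f \o linfun (@vrepr _ _ (Ann rho)))%VF.
have fbarE x : fbar (lpi (Ann rho) x) = f x.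
  rewrite comp_lfunE lfunE /=; apply/eqP; rewrite -subr_eq0 -(linearB f) /=.
  rewrite f0 //; apply/(lpi_eq0 (Ann rho)).
  by rewrite linearB /= [lpi _ (vrepr _)]vreprK subrr.
have [u v | s fs] := acyc fbar.
  by rewrite -[u]lreprK -[v]lreprK -lpi_morphism !fbarE Zf !Ann_moduleE.
by exists s => x; rewrite -fbarE fs Ann_moduleE.
Qed.

Lemma dim_H1_split_mult (C : chiefSeries L) :
  \dim (H1 rho) = (\dim (End_L rho) * split_mult C rho)%N <-> Ann_acyclic.
Proof.
rewrite Ann_acyclicP; have eqd := dim_H1 rho; rewrite (dim_cocycles C) in eqd.
have sB := coboundaries_vanish.
split=> [e | e]; last first.
  by apply/eqP; rewrite -(eqn_add2r (\dim (limg (ce_d0 rho)))) eqd e addnC.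
apply/eqP; rewrite eq_sym eqEdim sB /=.
by move: eqd; rewrite e addnC => /addIn->.
Qed.

End ChiefSeriesCount.

(** * Quotient, Hom and adjoint modules *)

Section Constructions.
Variables (F : fieldType) (L : lieAlgType F).

Section QuotientModule.
Variables (S : vectType F) (rho : lieModule L S) (U : {vspace S}).
Hypothesis subU : is_submodule rho U.

Let act (x : L) (u : vquot U) : vquot U := vpi U (rho x (vrepr u)).

Let act_pi x s : act x (vpi U s) = vpi U (rho x s).
Proof.
apply/vpi_eqP; rewrite -lactBr; apply: subU; apply/vpi_eqP; exact: vreprK.
Qed.
Let act_linearl u : linear (act^~ u).
Proof. by move=> a x y; rewrite /act lact_linearl linearP. Qed.
Let act_linearr x : linear (act x).
Proof.
move=> a u v; rewrite /act (linearP (@vrepr _ _ U)) lact_linearr.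
exact: (linearP (vpi U)).
Qed.
Let act_lie x y u : act [lie x, y] u = act x (act y u) - act y (act x u).
Proof. by rewrite -[u]vreprK !act_pi lact_lie linearB. Qed.

Definition quotient_module : lieModule L (vquot U) :=
  LieModule act_linearl act_linearr act_lie.

Lemma quotient_moduleE x s : quotient_module x (vpi U s) = vpi U (rho x s).
Proof. exact: act_pi. Qed.

End QuotientModule.

Section HomModule.
Variables (S T : vectType F) (rho : lieModule L S) (tau : lieModule L T).

Let act (x : L) (h : 'Hom(S, T)) : 'Hom(S, T) :=
  ((lact_hom tau x \o h) - (h \o lact_hom rho x))%VF.

Let actE x h s : act x h s = tau x (h s) - h (rho x s).
Proof. by rewrite add_lfunE opp_lfunE !comp_lfunE !hom_ofE. Qed.
Let act_linearl h : linear (act^~ h).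
Proof.
move=> a x y; apply/lfunP=> s; rewrite [RHS]add_lfunE scale_lfunE !actE.
by rewrite !lact_linearl linearP scalerBr opprD addrACA.
Qed.
Let act_linearr x : linear (act x).
Proof.
move=> a g h; apply/lfunP=> s; rewrite [RHS]add_lfunE scale_lfunE !actE.
by rewrite !add_lfunE !scale_lfunE lact_linearr scalerBr opprD addrACA.
Qed.
Let commutator_exchange (a b c d e g : T) :
  a - b - (c - d) = (a - e - (g - d)) - (b - g - (e - c)).
Proof.
rewrite !opprB !addrA [a - b + d]addrAC [_ - b - c]addrAC.
by rewrite [_ - g + e]addrAC [a - e + d]addrAC subrK [_ - c + g]addrAC subrK.
Qed.
Let act_lie x y h : act [lie x, y] h = act x (act y h) - act y (act x h).
Proof.
apply/lfunP=> s; rewrite [RHS]add_lfunE opp_lfunE !actE !lact_lie.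
rewrite !lactBr linearB; exact: commutator_exchange.
Qed.

Definition Hom_module : lieModule L 'Hom(S, T) :=
  LieModule act_linearl act_linearr act_lie.

Lemma Hom_moduleE x h s : Hom_module x h s = tau x (h s) - h (rho x s).
Proof. exact: actE. Qed.

End HomModule.

Section TrivialModule.
Variable S : vectType F.

Let act (x : L) (s : S) : S := 0.

Let act_linearl s : linear (act^~ s).
Proof. by move=> a x y; rewrite /act scaler0 addr0. Qed.
Let act_linearr x : linear (act x).
Proof. by move=> a x' y; rewrite /act scaler0 addr0. Qed.
Let act_lie x y s : act [lie x, y] s = act x (act y s) - act y (act x s).
Proof. by rewrite /act subrr. Qed.

Definition trivial_module : lieModule L S :=
  LieModule act_linearl act_linearr act_lie.

End TrivialModule.

Section AdjointModule.

Lemma lie_lie x y (z : L) : [lie [lie x, y], z] = [lie x, [lie y, z]] - [lie y, [lie x, z]].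
Proof.
have /eqP := lie_jacobi x y z.
by rewrite (lieC z [lie x, y]) subr_eq0 => /eqP <-; rewrite (lieC z x) lieNr.
Qed.

Definition adjoint_module : lieModule L L :=
  LieModule (@lie_linearl F L) (@lie_linearr F L) lie_lie.

End AdjointModule.

Lemma val_submodule (S : vectType F) (rho : lieModule L S) (T : {vspace S})
    (subT : is_submodule rho T) x (t : subvs_of T) :
  vsval (submodule subT x t) = rho x (vsval t).
Proof. by rewrite [LHS]vsprojK // subT // subvsP. Qed.

Lemma subvs_valB (S : vectType F) (T : {vspace S}) (u v : subvs_of T) :
  vsval (u - v) = vsval u - vsval v.
Proof. exact: (linearB (vsval : subvs_of T -> S)). Qed.

End Constructions.

(** * Modules without trivial subquotients *)

Section NoTrivialSubquotient.
Variables (F : fieldType) (L : lieAlgType F) (M : {vspace L}).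
Hypothesis idM : is_ideal M.

Section Def.
Variables (S : vectType F) (rho : lieModule L S).
Implicit Types (B C R U W : {vspace S}).

Definition act_into B C : Prop := forall m s, m \in M -> s \in B -> rho m s \in C.

(** The images of the B in this condition in the quotients by C are the trivial
M-subquotients of R; they are required to vanish. Allowing an arbitrary C, rather
than an M-stable one inside B, makes the condition easier to apply. *)
Definition no_trivial R : Prop :=
  forall B C, (B <= R)%VS -> act_into B B -> act_into B C -> (B <= C)%VS.

Lemma no_trivial0 : no_trivial 0%VS.
Proof. by move=> B C; rewrite subv0 => /eqP-> _ _; apply: sub0v. Qed.

Lemma no_trivialS U R : (U <= R)%VS -> no_trivial R -> no_trivial U.
Proof. by move=> sUR ntR B C sBU; apply: ntR; apply: subv_trans sUR. Qed.

Let memvB_l (u v : S) U : u - v \in U -> v \in U -> u \in U.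
Proof. by move=> Uuv Uv; rewrite -(subrK v u) memvD. Qed.

(** Modulo R, the translate x R is an M-equivariant image of R because [M, x] lies in
M, so it has no trivial subquotient either. *)
Lemma no_trivial_translate R x : act_into R R -> no_trivial R ->
  act_into (R + lact_hom rho x @: R) (R + lact_hom rho x @: R) /\
  no_trivial (R + lact_hom rho x @: R).
Proof.
move=> stR ntR; set R' := (R + _)%VS.
have memR' s : s \in R' -> exists r0 r1, [/\ r0 \in R, r1 \in R & s = r0 + rho x r1].
  case/memv_addP=> r0 Rr0 [_ /memv_imgP[r1 Rr1 ->] ->].
  by exists r0, r1; rewrite hom_ofE.
have R'I r0 r1 : r0 \in R -> r1 \in R -> r0 + rho x r1 \in R'.
  by move=> Rr0 Rr1; rewrite memv_add // -(hom_ofE (lact_linearr rho x)) memv_img.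
have Mmx m : m \in M -> [lie m, x] \in M by move=> Mm; rewrite lieC memvN idM.
split=> [m s Mm /memR'[r0 [r1 [Rr0 Rr1 ->]]] | B C sBR' stB MBC].
  rewrite lactDr lact_swap [rho x _ + _]addrC addrA.
  by rewrite R'I ?memvD ?stR // Mmx.
pose translated U := (R :&: lact_hom rho x @^-1: (U + R))%VS.
have memT U r : (r \in translated U) = (r \in R) && (rho x r \in (U + R)%VS).
  by rewrite memv_cap -memv_preim hom_ofE.
have translate_act U V : act_into U V -> act_into (translated U) (translated V).
  move=> MUV m r Mm; rewrite !memT => /andP[Rr /memv_addP[u Uu [r' Rr' xr]]].
  rewrite stR //= -[rho x _](addrK (rho [lie m, x] r)) -lact_swap xr lactDr -addrA.
  by rewrite memv_add ?MUV // memvB // stR // Mmx.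
have BR : (B :&: R <= C)%VS.
  apply: ntR; first exact: capvSr.
    move=> m s Mm; rewrite !memv_cap => /andP[Bs Rs].
    by rewrite stB ?stR.
  by move=> m s Mm; rewrite memv_cap => /andP[Bs _]; apply: MBC.
have stBC : act_into B (C :&: B).
  by move=> m s Mm Bs; rewrite memv_cap MBC ?stB.
have sT : (translated B <= translated (C :&: B))%VS.
  apply: ntR; first exact: capvSl.
    exact: translate_act.
  exact: translate_act.
apply/subvP=> b Bb; have [r0 [r1 [Rr0 Rr1 def_b]]] := memR' b (subvP sBR' b Bb).
have : r1 \in translated B.
  rewrite memT Rr1 -[rho x r1](addKr r0) -def_b addrC.
  by rewrite memv_add // memvN.
move/(subvP sT); rewrite memT => /andP[_ /memv_addP[c]].
rewrite memv_cap => /andP[Cc Bc] [r2 Rr2 xr1].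
apply: (@memvB_l _ c) => //; apply: (subvP BR); rewrite memv_cap memvB //=.
by rewrite def_b xr1 addrCA [c + _]addrC addrK memvD.
Qed.

(** A largest M-stable subspace without trivial subquotients absorbs its translates
by L, so it is an L-submodule, although only M-stability enters its choice. *)
Lemma max_no_trivial : exists R,
  [/\ is_submodule rho R, no_trivial R &
      forall W, act_into W W -> no_trivial W -> (R <= W)%VS -> W = R].
Proof.
have [|R [stR ntR] maxR] := @subspace_max _ _ (fun R => act_into R R /\ no_trivial R) 0%VS.
  split; last exact: no_trivial0.
  by move=> m s _; rewrite memv0 => /eqP->; rewrite lact0r mem0v.
exists R; split=> // [x s Rs | W stW ntW sRW].
  have [stR' ntR'] := no_trivial_translate x stR ntR.
  suff -> : R = (R + lact_hom rho x @: R)%VS.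
    rewrite -[rho x s]add0r memv_add ?mem0v //.
    by rewrite -(hom_ofE (lact_linearr rho x)) memv_img.
  by apply/eqP; rewrite eqEdim addvSl maxR.
by apply/eqP; rewrite eq_sym eqEdim sRW maxR.
Qed.

Lemma exists_act_into R : exists B, forall s, s \in B <-> forall m, m \in M -> rho m s \in R.
Proof.
apply: subspace_of_pred => [m _ | a u v Ru Rv m Mm]; first by rewrite lact0r mem0v.
by rewrite lact_linearr memvD ?memvZ ?Ru ?Rv.
Qed.

(** A minimal M-stable W strictly above R gives an irreducible M-module W / R. It is
not trivial if S / R has no invariants, and then W has no trivial subquotient. *)
Lemma max_no_trivial_socle R : act_into R R -> no_trivial R ->
    (forall W, act_into W W -> no_trivial W -> (R <= W)%VS -> W = R) ->
    (forall s, (forall m, m \in M -> rho m s \in R) -> s \in R) ->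
  R = fullv.
Proof.
move=> stR ntR maxR socR; apply/eqP/negbNE/negP=> /eqP R'S.
have [|W [stW [sRW W'R]] minW] := @subspace_min _ _
   (fun W => act_into W W /\ ((R <= W)%VS /\ W <> R)) fullv.
  by split; [move=> m s _ _; apply: memvf | split; [apply: subvf | move/esym]].
case: W'R; apply: maxR => // B C sBW stB MBC.
have BR : (B :&: R <= C)%VS.
  apply: ntR; first exact: capvSr.
    move=> m s Mm; rewrite !memv_cap => /andP[Bs Rs].
    by rewrite stB ?stR.
  by move=> m s Mm; rewrite memv_cap => /andP[Bs _]; apply: MBC.
have [sBCR | /eqP BC'R] := eqVneq (R + (B :&: C))%VS R.
  have sBR : (B <= R)%VS.
    apply/subvP=> b Bb; apply: socR => m Mm; rewrite -sBCR -[rho m b]add0r.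
    by rewrite memv_add ?mem0v // memv_cap stB ?MBC.
  by rewrite -(capv_idPl sBR).
have defW : (R + (B :&: C))%VS = W.
  apply/eqP; rewrite eqEdim minW; last first.
    split; last by split; [apply: addvSl |].
    move=> m _ Mm /memv_addP[r Rr [b + ->]]; rewrite memv_cap => /andP[Bb _].
    by rewrite lactDr memv_add ?stR // memv_cap stB ?MBC.
  by rewrite subv_add sRW (subv_trans (capvSl _ _)).
apply/subvP=> b Bb; have : b \in (R + (B :&: C))%VS by rewrite defW (subvP sBW).
case/memv_addP=> r Rr [c]; rewrite memv_cap => /andP[Bc Cc] def_b.
apply: (@memvB_l _ c) => //; apply: (subvP BR); rewrite memv_cap memvB //=.
by rewrite def_b addrK.
Qed.

End Def.

Lemma no_trivial_submodule (S : vectType F) (rho : lieModule L S) (T : {vspace S})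
    (subT : is_submodule rho T) (R : {vspace subvs_of T}) :
  no_trivial rho (linfun vsval @: R) -> no_trivial (submodule subT) R.
Proof.
have valE (t : subvs_of T) : linfun vsval t = vsval t by rewrite lfunE.
have memI (t : subvs_of T) U : (vsval t \in (linfun vsval @: U)%VS) = (t \in U).
  rewrite -valE; apply/idP/idP=> [/memv_imgP[u Uu] | /memv_img->//].
  by rewrite !valE => /val_inj->.
have act_img B C : act_into (submodule subT) B C ->
    act_into rho (linfun vsval @: B) (linfun vsval @: C).
  move=> MBC m _ Mm /memv_imgP[t Bt ->].
  by rewrite valE -(val_submodule subT) memI MBC.
move=> ntR B C sBR stB MBC; apply/subvP=> t Bt; rewrite -memI.
have /subvP : (linfun vsval @: B <= linfun vsval @: C)%VS.
  by apply: ntR; [apply: limgS | apply: act_img | apply: act_img].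
by apply; rewrite memI.
Qed.

Lemma no_trivial_quotient (S : vectType F) (rho : lieModule L S) (U : {vspace S})
    (subU : is_submodule rho U) :
  no_trivial rho fullv -> no_trivial (quotient_module subU) fullv.
Proof.
move=> nt B C _ stB MBC; apply/subvP=> u; rewrite -[u]vreprK.
have memP s D : (s \in (vpi U @^-1: D)%VS) = (vpi U s \in D) by rewrite -memv_preim.
rewrite -!memP; apply/subvP/nt; first exact: subvf.
  by move=> m s Mm; rewrite !memP -quotient_moduleE; apply: stB.
by move=> m s Mm; rewrite !memP -quotient_moduleE; apply: MBC.
Qed.

Hypothesis acyclic_irr : forall (S : vectType F) (rho : lieModule L S),
  irreducible rho -> ~ (M <= Ann_space rho)%VS -> acyclic rho.

(** Devissage: a reducible module has a proper submodule, and both this submodule and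
the quotient inherit the absence of trivial subquotients. *)
Lemma no_trivial_acyclic (S : vectType F) (rho : lieModule L S) :
  no_trivial rho fullv -> acyclic rho.
Proof.
have [n] := ubnP (\dim (fullv : {vspace S})); elim: n S rho => // n IHn S rho.
rewrite ltnS => le_n nt f Zf.
have [S0 | /eqP nzS] := eqVneq (fullv : {vspace S}) 0%VS.
  have zero s : s = 0 :> S by apply/eqP; rewrite -memv0 -S0 memvf.
  by exists 0 => x; rewrite (zero (f x)) lact0r.
case: (boolp.EM (irreducible rho)) => [irrS | redS].
  apply: acyclic_irr => // sMA.
  apply: nzS; apply/eqP; rewrite -subv0; apply: nt => // m s Mm _.
    exact: memvf.
  by move/subvP/(_ m Mm)/Ann_spaceP: sMA => ->; apply: mem0v.
have [U [subU nzU U'S]] : exists U, [/\ is_submodule rho U, U <> 0%VS & U <> fullv].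
  apply: boolp.contrapT => noU; apply: redS; split=> // U subU.
  have [-> | /eqP nzU] := eqVneq U 0%VS; first by left.
  by right; apply: boolp.contrapT => U'S; apply: noU; exists U.
have dimU : (\dim U < \dim (fullv : {vspace S}))%N.
  by rewrite ltn_neqAle dimvS ?subvf // andbT; apply/eqP=> e; apply: U'S;
     apply/eqP; rewrite eqEdim subvf e leqnn.
have [s fs] : coboundary (quotient_module subU) (vpi U \o f)%VF; first apply: IHn.
- apply: leq_trans le_n; rewrite -(limg_ker_dim (vpi U) fullv) vpi_surj lker_vpi.
  rewrite capfv -[X in (X < _)%N]add0n ltn_add2r lt0n dimv_eq0; exact/eqP.
- exact: no_trivial_quotient.
- by move=> x y; rewrite !comp_lfunE Zf !quotient_moduleE; exact: (linearB (vpi U)).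
pose g := f - ce_d0 rho (vrepr s).
have Ug x : g x \in U.
  rewrite add_lfunE opp_lfunE ce_d0E; apply/vpi_eqP.
  by have := fs x; rewrite -{1}[s]vreprK quotient_moduleE comp_lfunE.
have Zg : cocycle rho g.
  apply: cocycleD => //; apply: cocycleN; apply: coboundary_cocycle.
  by exists (vrepr s) => x; rewrite ce_d0E.
have gE x : vsval ((linfun (vsproj U) \o g)%VF x) = g x.
  by rewrite comp_lfunE lfunE /= vsprojK.
have [t gt] : coboundary (submodule subU) (linfun (vsproj U) \o g)%VF; first apply: IHn.
- by rewrite dimvf /dim /= (leq_trans dimU).
- by apply: no_trivial_submodule; apply: no_trivialS nt; apply: subvf.
- move=> x y; apply: val_inj.
  rewrite [LHS]gE [RHS]subvs_valB !val_submodule !gE.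
  exact: Zg.
exists (vrepr s + vsval t) => x; rewrite lactDr -(val_submodule subU) -gt gE.
by rewrite add_lfunE opp_lfunE ce_d0E addrC subrK.
Qed.

(** When M S <= R this space is, as an M-module, a sum of copies of R, and as an
L-module it is Hom(S / R, R). *)
Lemma exists_square_zero_maps (S : vectType F) (R : {vspace S}) :
  exists N : {vspace 'End(S)}, forall h,
    h \in N <-> (forall s, h s \in R) /\ (forall s, s \in R -> h s = 0).
Proof.
apply: subspace_of_pred => [|a g h [gR g0] [hR h0]].
  by split=> [s|s _]; rewrite zero_lfunE // mem0v.
split=> s *; rewrite add_lfunE scale_lfunE; first by rewrite memvD ?memvZ.
by rewrite g0 // h0 // scaler0 addr0.
Qed.

(** On N the algebra M acts through the values of the maps, so evaluation at a vector
is an M-map into R; evaluating at a spanning family embeds N in a power of R. *)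
Lemma no_trivial_maps (S : vectType F) (rho : lieModule L S) (R : {vspace S})
    (N : {vspace 'End(S)}) :
    no_trivial rho R -> (forall m s, m \in M -> rho m s \in R) ->
    (forall h, h \in N -> (forall s, h s \in R) /\ (forall s, s \in R -> h s = 0)) ->
  no_trivial (Hom_module rho rho) N.
Proof.
move=> ntR MS memN.
have actN m h s : m \in M -> h \in N -> Hom_module rho rho m h s = rho m (h s).
  by move=> Mm /memN[_ h0]; rewrite Hom_moduleE (h0 (rho m s)) ?subr0 ?MS.
suff evals (r : seq S) B C : (B <= N)%VS ->
    act_into (Hom_module rho rho) B B -> act_into (Hom_module rho rho) B C ->
    (forall h, h \in B -> (forall s, s \in r -> h s = 0) -> h = 0) -> (B <= C)%VS.
  move=> B C sBN stB MBC; apply: (evals (vbasis fullv)) => // h _ h0.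
  apply/lfunP=> s; rewrite zero_lfunE (coord_vbasis (memvf s)) linear_sum big1 // => i _.
  by rewrite linearZ /= h0 ?scaler0 // mem_nth ?size_tuple.
elim: r B C => [|s r IHr] B C /subvP sBN stB MBC h0B.
  by apply/subvP=> h Bh; rewrite (h0B h) // mem0v.
have ev_lin : linear (fun h : 'End(S) => h s).
  by move=> a g h; rewrite add_lfunE scale_lfunE.
have evE h : hom_of ev_lin h = h s by rewrite hom_ofE.
have sBC : (B :&: lker (hom_of ev_lin) <= C)%VS.
  apply: IHr.
  - by apply/subvP=> h; rewrite memv_cap => /andP[/sBN].
  - move=> m h Mm; rewrite !memv_cap !memv_ker !evE => /andP[Bh /eqP hs].
    by rewrite stB //= actN ?sBN // hs lact0r.
  - by move=> m h Mm; rewrite memv_cap => /andP[Bh _]; apply: MBC.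
  move=> h; rewrite memv_cap memv_ker evE => /andP[Bh /eqP hs] hr.
  by apply: h0B => // t; rewrite inE => /predU1P[->|/hr].
have act_ev D : act_into (Hom_module rho rho) B D ->
    act_into rho (hom_of ev_lin @: B) (hom_of ev_lin @: D).
  move=> MBD m _ Mm /memv_imgP[h Bh ->].
  by rewrite evE -actN ?sBN // -evE memv_img // MBD.
have sev : (hom_of ev_lin @: B <= hom_of ev_lin @: (C :&: B))%VS.
  apply: ntR; last 1 first.
  - by apply: act_ev => m h Mm Bh; rewrite memv_cap MBC ?stB.
  - by apply/subvP=> _ /memv_imgP[h /sBN/memN[hR _] ->]; rewrite evE.
  exact: act_ev.
apply/subvP=> h Bh; have := subvP sev _ (memv_img (hom_of ev_lin) Bh).
case/memv_imgP=> c; rewrite memv_cap !evE => /andP[Cc Bc] hc.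
rewrite -(subrK c h) memvD //; apply: (subvP sBC).
by rewrite memv_cap memvB //= memv_ker linearB /= !evE hc subrr.
Qed.

(** For a projection pi onto R, x |-> x.pi is a cocycle with values in Hom(S / R, R),
which has no H^1. Correcting pi accordingly gives an L-equivariant projection q
onto R. Since M S <= R, each s - q s is an M-invariant, hence zero. *)
Lemma no_trivial_split (S : vectType F) (rho : lieModule L S) (R : {vspace S}) :
    is_submodule rho R -> no_trivial rho R ->
    (forall m s, m \in M -> rho m s \in R) ->
    (forall s, (forall m, m \in M -> rho m s = 0) -> s = 0) ->
  R = fullv.
Proof.
move=> subR ntR MS invS.
have [N memN] := exists_square_zero_maps R.
have subN : is_submodule (Hom_module rho rho) N.
  move=> x h /memN[hR h0]; apply/memN; split=> [s | s Rs]; rewrite Hom_moduleE.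
    by rewrite memvB // subR.
  by rewrite h0 // h0 ?subR // lact0r subrr.
have acycN : acyclic (submodule subN).
  apply: no_trivial_acyclic; apply: no_trivial_submodule.
  apply: no_trivialS (no_trivial_maps ntR MS (fun h => (memN h).1)).
  by apply/subvP=> _ /memv_imgP[h _ ->]; rewrite lfunE subvsP.
pose pi : 'End(S) := projv R.
pose d := ce_d0 (Hom_module rho rho) pi.
have dN x : d x \in N.
  apply/memN; rewrite ce_d0E; split=> [s | s Rs]; rewrite Hom_moduleE.
    by rewrite memvB ?subR // memv_proj.
  by rewrite !projv_id ?subR // subrr.
pose f := (linfun (vsproj N) \o d)%VF.
have fE x : vsval (f x) = d x by rewrite comp_lfunE lfunE /= vsprojK.
have [x y | h fh] := acycN f.
  apply: val_inj; rewrite [LHS]fE [RHS]subvs_valB !val_submodule !fE.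
  by rewrite !ce_d0E lact_lie.
pose q := pi - vsval h.
have [hR h0] := (memN (vsval h)).1 (subvsP h).
have qC x s : rho x (q s) = q (rho x s).
  apply/eqP; rewrite -subr_eq0 -Hom_moduleE /q lactBr -(val_submodule subN) -fh fE.
  by rewrite ce_d0E subrr zero_lfunE.
have q_id s : s \in R -> q s = s.
  by move=> Rs; rewrite add_lfunE opp_lfunE projv_id // h0 // subr0.
apply/eqP; rewrite eqEsubv subvf; apply/subvP=> s _.
have : s - q s = 0.
  by apply: invS => m Mm; rewrite lactBr qC q_id ?subrr ?MS.
move/eqP; rewrite subr_eq0 => /eqP->.
by rewrite add_lfunE opp_lfunE memvB ?memv_proj.
Qed.

(** Take R maximal among the subspaces without trivial subquotients, and let B / R be
the M-invariants of S / R. The extension B of B / R by R splits, so B = R; then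
R = S by [max_no_trivial_socle]. *)
Lemma no_invariants_no_trivial (S : vectType F) (rho : lieModule L S) :
    (forall s, (forall m, m \in M -> rho m s = 0) -> s = 0) ->
  no_trivial rho fullv.
Proof.
move=> invS; have [R [subR ntR maxR]] := max_no_trivial rho.
suff -> : fullv = R by [].
apply/esym/(@max_no_trivial_socle _ rho R) => // [m s _ | s0 s0R]; first exact: subR.
have [B memB] := exists_act_into rho R.
have subB : is_submodule rho B.
  move=> x s /memB sR; apply/memB=> m Mm; rewrite lact_swap memvD //.
    by apply/subR/sR.
  by apply: sR; rewrite lieC memvN idM.
have sRB : (R <= B)%VS by apply/subvP=> s Rs; apply/memB=> m _; apply: subR.
pose RB := (linfun (@vsval _ _ B) @^-1: R)%VS.
have memRB t : (t \in RB) = (vsval t \in R) by rewrite -memv_preim lfunE.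
have /vspaceP/(_ (vsproj B s0)) : RB = fullv.
  apply: (no_trivial_split (rho := submodule subB)).
  - by move=> x t; rewrite !memRB val_submodule; apply: subR.
  - apply: no_trivial_submodule; apply: no_trivialS ntR.
    by apply/subvP=> _ /memv_imgP[t + ->]; rewrite memRB lfunE.
  - by move=> m t Mm; rewrite memRB val_submodule; apply: (memB _).1 Mm; apply: subvsP.
  move=> t t0; apply: val_inj; apply: (etrans (invS _ _)) => [m Mm|].
    by rewrite -(val_submodule subB) t0 // linear0.
  by rewrite linear0.
by rewrite memvf memRB vsprojK //; apply/memB.
Qed.

End NoTrivialSubquotient.

(** * p-th powers and derivations in characteristic p *)

Section PthPowers.
Variables (R : idomainType) (p : nat) (charR : p \in [pchar R]).
Implicit Types (u v w : R) (y z : {poly R}).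

Let pr_p : prime p := pcharf_prime charR.
Let p_gt0 : (0 < p)%N := prime_gt0 pr_p.
Let mulrp0 v : v *+ p = 0. Proof. by rewrite -mulr_natr (pcharf0 charR) mulr0. Qed.

Lemma coef_deriv_pred y : y^`()`_p.-1 = 0.
Proof. by rewrite coef_deriv prednK // mulrp0. Qed.

(** The polynomial y^k y' is the derivative of y^(k+1) / (k+1), and derivatives have no term of
degree p - 1. *)
Lemma coef_powM_deriv y k : (k.+1 < p)%N -> (y ^+ k * y^`())`_p.-1 = 0.
Proof.
move=> ltkp; have := coef_deriv_pred (y ^+ k.+1).
rewrite deriv_exp /= coefMn -mulr_natr => /eqP; rewrite mulf_eq0 orbC.
rewrite -(dvdn_pcharf charR) gtnNdvd //= mulrC => /eqP.
by rewrite mulrC.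
Qed.

(** This is the Cartier operator on the differential form y^(p-1) dy. Writing
y = c + a with c constant, all terms of the binomial expansion of y^(p-1) a' are
derivatives, except a^(p-1) a', where a is divisible by 'X. *)
Lemma cartier_coef y : (y ^+ p.-1 * y^`())`_p.-1 = y`_1 ^+ p.
Proof.
have [q [c ->]] : exists q c, y = q * 'X + c%:P.
  by elim/poly_ind: y => [|q c _]; [exists 0, 0; rewrite mul0r add0r | exists q, c].
rewrite derivD derivC addr0 coefD coefC addr0 coefMX /=; set a := q * 'X.
rewrite addrC exprDn mulr_suml coef_sum -(prednK p_gt0) big_ord_recr /= big1 ?add0r.
  rewrite subnn expr0 mul1r binn mulr1n /a exprMn mulrAC coefMXn ltnn subnn.
  rewrite derivM derivX mulr1 -!horner_coef0 !hornerE /=.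
  by rewrite -exprSr prednK.
move=> i _; rewrite -polyC_exp mulrnAl coefMn -mulrA coefCM.
by rewrite coef_powM_deriv ?mulr0 ?mul0rn //; have := ltn_ord i; rewrite -ltnS prednK.
Qed.

Variable D : R -> R.
Hypotheses (DD : forall u v, D (u + v) = D u + D v)
           (DM : forall u v, D (u * v) = D u * v + u * D v).

Let D0 : D 0 = 0.
Proof. by apply: (addrI (D 0)); rewrite -DD !addr0. Qed.
Let DMn v n : D (v *+ n) = D v *+ n.
Proof. by elim: n => [|n IHn]; rewrite ?mulr0n // !mulrS DD IHn. Qed.
Let Dsum I (r : seq I) (P : pred I) (G : I -> R) :
  D (\sum_(i <- r | P i) G i) = \sum_(i <- r | P i) D (G i).
Proof. exact: (big_morph D DD D0). Qed.

Let Dp : {poly R} -> {poly R} := map_poly D.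
Let coefDp y i : (Dp y)`_i = D y`_i.
Proof. by rewrite coef_map_id0. Qed.
Let DpM y z : Dp (y * z) = Dp y * z + y * Dp z.
Proof.
apply/polyP=> i; rewrite coefD coefDp !coefM Dsum -big_split; apply: eq_bigr => j _ /=.
by rewrite DM !coefDp.
Qed.
Let Dp_exp y n : Dp (y ^+ n.+1) = (y ^+ n * Dp y) *+ n.+1.
Proof.
elim: n => [|n IHn]; first by rewrite expr1 mul1r.
rewrite exprS DpM IHn [RHS]mulrS [Dp y * _]mulrC; congr (_ + _).
by rewrite mulrnAr mulrA -exprS.
Qed.

(** (p-1)! times the exponential series of t D applied to w, truncated at t^p; the
factor (p-1)!, which is -1 modulo p, clears the denominators. *)
Definition trunc_exp w : {poly R} :=
  \poly_(k < p) (iter k D w *+ (p.-1 ^_ (p.-1 - k))).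

(** Let y be the truncated exponential of w and Z = y^(p-1) D y. Since y satisfies
y' = D y up to a term in t^(p-1), Z satisfies Z' = D Z up to multiples of t^(p-1),
and comparing coefficients of t^(p-2) gives D Z_(p-2) = (p-1) Z_(p-1). On the
other hand Z is the sum of y^(p-1) y' and y^(p-1) t^(p-1) D^p w, whose
coefficients of t^(p-1) are - (D w)^p by [cartier_coef] and w^(p-1) D^p w. *)
Lemma pth_power_derivation w :
  w ^+ p.-1 * iter p D w - D w ^+ p
  = - D (trunc_exp w ^+ p.-1 * Dp (trunc_exp w))`_p.-2.
Proof.
set y := trunc_exp w; set c := iter p D w.
have sgn : ((p.-1)`!)%:R = -1 :> R.
  by apply/eqP; rewrite -addr_eq0 natr1 -(dvdn_pcharf charR) -Wilson // prime_gt1.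
have p1E : p.-1%:R = -1 :> R.
  by apply/eqP; rewrite -addr_eq0 natr1 prednK // (pcharf0 charR).
have y_coef k : (k < p)%N -> y`_k = iter k D w *+ (p.-1 ^_ (p.-1 - k)).
  by move=> ltkp; rewrite coef_poly ltkp.
have y0 : y`_0 = - w by rewrite y_coef // subn0 ffactnn -mulr_natr sgn mulrN1.
have y1 : y`_1 = - D w.
  rewrite y_coef ?prime_gt1 //; have p1_gt0 : (0 < p.-1)%N by rewrite -ltnS prednK ?prime_gt1.
  have := ffact_fact (leq_subr 1 p.-1); rewrite subKn // muln1 => ->.
  by rewrite -mulr_natr sgn mulrN1.
have Dy : Dp y = y^`() + c *: 'X^(p.-1).
  apply/polyP=> k; rewrite coefDp coefD coef_deriv coefZ coefXn.
  have [ltkp | lepk] := ltnP k p; last first.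
    rewrite !nth_default ?D0 ?mul0rn ?add0r ?(leq_trans (size_poly _ _)) ?leqW //.
    by rewrite gtn_eqF ?mulr0 // prednK.
  rewrite y_coef // DMn -iterS; have [-> | k'p] := eqVneq k p.-1.
    by rewrite subnn ffactn0 prednK // mulrp0 add0r mulr1.
  have ltk1p : (k.+1 < p)%N.
    by rewrite ltn_neqAle ltkp andbT -(prednK p_gt0) eqSS.
  rewrite mulr0 addr0 y_coef // -mulrnA; congr (_ *+ _).
  have -> : (p.-1 - k = (p.-1 - k.+1).+1)%N by rewrite subnSK // -ltnS prednK.
  rewrite ffactnSr; congr (_ * _)%N.
  by rewrite subKn // -ltnS prednK.
pose Z : {poly R} := y ^+ p.-1 * Dp y.
have Zp : Z`_p.-1 = w ^+ p.-1 * c - D w ^+ p.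
  rewrite /Z Dy mulrDr coefD cartier_coef y1 mulrC -scalerAl coefZ.
  rewrite coefXnM ltnn subnn -horner_coef0 horner_exp horner_coef0 y0.
  have expN v : (- v) ^+ p = - v ^+ p by rewrite -!(pFrobenius_autE charR) rmorphN.
  rewrite expN addrC mulrC exprNn; congr (_ * _ - _); rewrite -[RHS]mul1r; congr (_ * _).
  by apply: oppr_inj; rewrite -[LHS]mulN1r -exprS prednK // expN expr1n.
have p1_gt0 : (0 < p.-1)%N by rewrite -ltnS prednK ?prime_gt1.
have [W DZ] : exists W, Dp Z = Z^`() + W * 'X^(p.-1).
  exists ((y ^+ p.-2 * Dp y) *+ p.-1 * c%:P + y ^+ p.-1 * (D c)%:P).
  have DDy : Dp (Dp y) = (Dp y)^`() + D c *: 'X^(p.-1).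
    apply/polyP=> k; rewrite {1}Dy coefD coefDp !coefD DD !coef_deriv coefDp DMn.
    by rewrite !coefZ coefXn; case: eqP; rewrite ?mulr1 ?mulr0 ?D0.
  rewrite DpM DDy -(prednK p1_gt0) Dp_exp derivM deriv_exp /= prednK //.
  rewrite {1}Dy -!mul_polyC !(mulrDl, mulrDr).
  by ring.
rewrite -/Z -Zp -coefDp DZ coefD coefMXn ltn_predL p1_gt0 addr0 coef_deriv prednK //.
by rewrite -[X in - X]mulr_natr p1E mulrN1 opprK.
Qed.

End PthPowers.

(** * Symmetric powers of the adjoint module *)

Section SymmetricPower.
Variables (F : fieldType) (L : lieAlgType F) (n : nat).
Variables (b : n.+1.-tuple L) (basis_b : basis_of fullv b).

Notation poly_L := {mpoly F[n.+1]}.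

Definition linear_form (w : L) : poly_L := \sum_i coord b i w *: 'X_i.

Fact linear_form_linear : linear linear_form.
Proof.
move=> a u v; rewrite /linear_form scaler_sumr -big_split; apply: eq_bigr => i _ /=.
by rewrite linearP scalerDl scalerA.
Qed.
HB.instance Definition _ :=
  GRing.isLinear.Build F L poly_L *:%R linear_form linear_form_linear.

Lemma linear_form_inj w : linear_form w = 0 -> w = 0.
Proof.
move=> w0; rewrite (coord_basis basis_b (memvf w)) big1 // => i _.
have := congr1 (mcoeff U_(i)) w0; rewrite mcoeff0 raddf_sum /= (bigD1 i) //=.
rewrite mcoeffZ mcoeffXU eqxx mulr1 big1 ?addr0 => [-> | j ji]; first by rewrite scale0r.
by rewrite mcoeffZ mcoeffXU (negPf ji) mulr0.
Qed.

(** The derivation of the symmetric algebra of L extending ad x. *)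
Definition ad_der (x : L) (f : poly_L) : poly_L :=
  \sum_i linear_form [lie x, tnth b i] * f^`M(i).

Lemma ad_der_linearl f : linear (ad_der^~ f).
Proof.
move=> a x y; rewrite /ad_der scaler_sumr -big_split; apply: eq_bigr => i _ /=.
by rewrite lie_linearl linearP mulrDl scalerAl.
Qed.

Lemma ad_der_linear x : linear (ad_der x).
Proof.
move=> a f g; rewrite /ad_der scaler_sumr -big_split; apply: eq_bigr => i _ /=.
by rewrite linearP mulrDr scalerAr.
Qed.
HB.instance Definition _ x :=
  GRing.isLinear.Build F poly_L poly_L *:%R (ad_der x) (ad_der_linear x).

Lemma ad_derM x f g : ad_der x (f * g) = ad_der x f * g + f * ad_der x g.
Proof.
rewrite /ad_der mulr_suml mulr_sumr -big_split; apply: eq_bigr => i _ /=.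
by rewrite mderivM mulrDr [f * (_ * _)]mulrCA -mulrA.
Qed.

Lemma mderiv_var (i j : 'I_n.+1) : ('X_i : poly_L)^`M(j) = (i == j)%:R.
Proof.
rewrite mderivX mnm1E; case: eqP => [-> | _]; last by rewrite scale0r.
have -> : (U_(j) - U_(j) = 0 :> 'X_{1..n.+1})%MM.
  by apply/mnmP=> k; rewrite mnmBE mnm0E subnn.
by rewrite scale1r mpolyX0.
Qed.

Lemma ad_der_linear_form x w : ad_der x (linear_form w) = linear_form [lie x, w].
Proof.
have lie_sum : [lie x, \sum_i coord b i w *: b`_i] = \sum_i coord b i w *: [lie x, b`_i].
  rewrite (big_morph (lie_bracket x) (lieDr x) (lie0r x)).
  by apply: eq_bigr => i _; rewrite lieZr.
rewrite {2}(coord_basis basis_b (memvf w)) lie_sum !linear_sum; apply: eq_bigr => i _.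
rewrite !linearZ /= /ad_der (bigD1 i) //= big1 ?addr0 => [|j ji].
  by rewrite mderiv_var eqxx mulr1 (tnth_nth 0).
by rewrite mderiv_var eq_sym (negPf ji) mulr0.
Qed.

(** The second-order terms of the two compositions agree, as partial derivatives
commute. *)
Lemma ad_der_lie x y f : ad_der [lie x, y] f = ad_der x (ad_der y f) - ad_der y (ad_der x f).
Proof.
pose S x y := \sum_i \sum_j
  linear_form [lie y, tnth b i] * (linear_form [lie x, tnth b j] * f^`M(i)^`M(j)).
have SC : S x y = S y x.
  rewrite /S exchange_big; apply: eq_bigr => i _; apply: eq_bigr => j _.
  by rewrite mulrCA mderiv_comm.
have der2 u v : ad_der u (ad_der v f) =
    \sum_i linear_form [lie u, [lie v, tnth b i]] * f^`M(i) + S u v.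
  rewrite {2}/ad_der linear_sum -big_split; apply: eq_bigr => i _ /=.
  by rewrite ad_derM ad_der_linear_form /ad_der mulr_sumr.
rewrite !der2 SC opprD addrACA subrr addr0 -sumrB; apply: eq_bigr => i _.
by rewrite -mulrBl -linearB -lie_lie.
Qed.

Lemma mderiv_homog d i (f : poly_L) : f \is d.+1.-homog -> f^`M(i) \is d.-homog.
Proof.
move/dhomogP=> hf; apply/dhomogP=> m; rewrite mcoeff_msupp mcoeff_deriv => nz.
have : (m + U_(i))%MM \in msupp f.
  by rewrite mcoeff_msupp; apply: contraNneq nz => ->; rewrite mul0rn.
by move/hf => /=; rewrite mdegD mdeg1 addn1 => -[].
Qed.

Lemma linear_form_homog w : linear_form w \is 1.-homog.
Proof. by apply: rpred_sum => i _; apply: rpredZ; rewrite dhomogX /= mdeg1. Qed.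

Lemma ad_der_homog d x (f : poly_L) : f \is d.+1.-homog -> ad_der x f \is d.+1.-homog.
Proof.
move=> hf; apply: rpred_sum => i _; rewrite -[d.+1]add1n.
by apply: dhomogM; [apply: linear_form_homog | apply: mderiv_homog].
Qed.

(** The symmetric power S^(d+1) L of the adjoint module. *)
Section Power.
Variable d : nat.

Let act (x : L) (v : dhomog n.+1 F d.+1) : dhomog n.+1 F d.+1 :=
  DHomog (ad_der_homog x (dhomog_is_dhomog v)).

Let act_linearl v : linear (act^~ v).
Proof. by move=> a x y; apply: val_inj; exact: ad_der_linearl. Qed.
Let act_linearr x : linear (act x).
Proof. by move=> a u v; apply: val_inj; exact: ad_der_linear. Qed.
Let act_lie x y v : act [lie x, y] v = act x (act y v) - act y (act x v).
Proof. by apply: val_inj; exact: ad_der_lie. Qed.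

Definition sym_module : lieModule L (dhomog n.+1 F d.+1) :=
  LieModule act_linearl act_linearr act_lie.

End Power.

Lemma coef_exp_homog (y : {poly poly_L}) k :
  (forall i, y`_i \is 1.-homog) -> forall i, (y ^+ k)`_i \is k.-homog.
Proof.
move=> y1; elim: k => [|k IHk] i.
  by rewrite expr0 coef1; case: eqP; rewrite ?dhomog1 ?rpred0.
rewrite exprS coefM; apply: rpred_sum => j _; rewrite -[k.+1]add1n.
exact: dhomogM.
Qed.

Lemma ad_der_exp x f k : ad_der x (f ^+ k.+1) = (f ^+ k * ad_der x f) *+ k.+1.
Proof.
elim: k => [|k IHk]; first by rewrite expr1 mul1r.
rewrite exprS ad_derM IHk [RHS]mulrS [ad_der x f * _]mulrC; congr (_ + _).
by rewrite mulrnAr mulrA -exprS.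
Qed.

Lemma iter_ad_der x w k :
  iter k (ad_der x) (linear_form w) = linear_form (iter k (lie_bracket x) w).
Proof. by elim: k => //= k ->; apply: ad_der_linear_form. Qed.

Section PthPowerInSpan.
Variables (q : nat) (charF : q.+1 \in [pchar F]).

Let V := dhomog n.+1 F q.+1.
Let charP : q.+1 \in [pchar poly_L].
Proof. exact: (rmorph_pchar (@mpolyC n.+1 F)). Qed.

Let pow_homog k w : linear_form w ^+ k \is k.-homog.
Proof. by rewrite -[X in X.-homog]mul1n; apply: dhomogMn (linear_form_homog w). Qed.

Definition pth_power (w : L) : V := DHomog (pow_homog q.+1 w).

Lemma pth_power_invariant x w : sym_module q x (pth_power w) = 0.
Proof.
apply: val_inj; rewrite /= ad_der_exp -mulr_natr.
by rewrite (pcharf0 charP) mulr0.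
Qed.

Lemma pth_power_inj w : pth_power w = 0 -> w = 0.
Proof.
move/(congr1 val)=> /= /eqP; rewrite expf_eq0 /= => /eqP.
exact: linear_form_inj.
Qed.

Let theta_homog w x : linear_form w ^+ q * linear_form [lie x, w] \is q.+1.-homog.
Proof.
by rewrite -(addn1 q); apply: dhomogM; [apply: pow_homog | apply: linear_form_homog].
Qed.

Let theta w x : V := DHomog (theta_homog w x).

Let theta_linear w : linear (theta w).
Proof.
move=> a x y; apply: val_inj.
by rewrite /= lie_linearl linearP mulrDr scalerAr.
Qed.

(** In w^(p-1) both derivations produce w^(p-2) [x, w] [y, w], which is symmetric in
x and y, so that these terms cancel. *)
Let theta_lie w x y :
  theta w [lie x, y] = sym_module q x (theta w y) - sym_module q y (theta w x).
Proof.
apply: val_inj; rewrite /= !ad_derM !ad_der_linear_form.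
rewrite lie_lie linearB mulrBr /= addrC.
set A := ad_der x _ * _; suff -> : A = ad_der y (linear_form w ^+ q) * linear_form [lie x, w].
  by rewrite opprD addrACA subrr add0r addrC.
rewrite /A; case: (q) => [|k]; last first.
  rewrite !ad_der_exp !ad_der_linear_form !mulrnAl -!mulrA.
  by rewrite [_ * linear_form [lie x, w]]mulrC.
by rewrite expr0 /ad_der !big1 ?mul0r // => i _; rewrite mderivC mulr0.
Qed.

(** By [theta_lie], w^q [a, w] lies in U for all a in [M, M], in particular for
a = x'. By [pth_power_derivation] it differs from [x, w]^(q+1) by an element of
x V. *)
Lemma pth_power_mem (M : {vspace L}) (U : {vspace V}) x x' w :
    (M <= liespan M M)%VS -> x \in M -> x' \in M ->
    (forall u, iter q.+1 (lie_bracket x) u = [lie x', u]) ->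
    (forall m v, m \in M -> sym_module q m v \in U) ->
  pth_power [lie x, w] \in U.
Proof.
move=> perfM Mx Mx' xpE MU.
have [|a u v Uu Uv | W memW] := @subspace_of_pred _ _ (fun a => theta w a \in U).
- have ->: theta w 0 = 0; last exact: mem0v.
  by apply: val_inj; rewrite /= lie0l linear0 mulr0.
- by rewrite theta_linear memvD ?memvZ.
have theta_x' : theta w x' \in U.
  apply/memW; apply: subvP Mx'; apply: subv_trans perfM _.
  by apply/liespanP=> a c Ma Mc; apply/memW; rewrite theta_lie memvB ?MU.
pose D := ad_der x; pose y := trunc_exp q.+1 D (linear_form w).
have y_homog i : y`_i \is 1.-homog.
  rewrite coef_poly; case: ifP => _; last exact: rpred0.
  by rewrite iter_ad_der rpredMn // linear_form_homog.
have z_homog : (y ^+ q * map_poly D y)`_q.-1 \is q.+1.-homog.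
  rewrite -(addn1 q) coefM; apply: rpred_sum => j _; apply: dhomogM.
    exact: coef_exp_homog.
  rewrite coef_map_id0; last exact: (linear0 (ad_der x)).
  exact: ad_der_homog (y_homog _).
have -> : pth_power [lie x, w] = theta w x' + sym_module q x (DHomog z_homog).
  apply: val_inj; rewrite /= -xpE -iter_ad_der -ad_der_linear_form.
  have := @pth_power_derivation _ _ charP D (linearD (ad_der x)) (ad_derM x) (linear_form w).
  by move/eqP; rewrite subr_eq => /eqP->; rewrite addrAC addNr add0r.
by rewrite memvD ?MU.
Qed.

End PthPowerInSpan.

End SymmetricPower.

(** * Invariants of a perfect ideal *)

Section PerfectIdeal.
Variables (F : fieldType) (L : lieAlgType F) (M : {vspace L}).
Hypotheses (idM : is_ideal M) (perfM : (M <= liespan M M)%VS).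
Hypothesis acyclic_irr : forall (S : vectType F) (rho : lieModule L S),
  irreducible rho -> ~ (M <= Ann_space rho)%VS -> acyclic rho.

(** For M perfect, M M S = M S: use [a, b] s = a (b s) - b (a s). *)
Lemma perfect_act_into (S : vectType F) (rho : lieModule L S) (B C : {vspace S}) :
  (forall m s, m \in M -> rho m s \in B) -> act_into M rho B C ->
  forall m s, m \in M -> rho m s \in C.
Proof.
move=> MS_B MB_C m s Mm.
have [|a u v Cu Cv | W memW] := @subspace_of_pred _ _ (fun m => rho m s \in C).
- by rewrite lact0l mem0v.
- by rewrite lact_linearl memvD ?memvZ.
apply/memW; apply: subvP Mm; apply: subv_trans perfM _.
by apply/liespanP=> a b Ma Mb; apply/memW; rewrite lact_lie memvB ?MB_C ?MS_B.
Qed.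

Lemma exists_span_act (S : vectType F) (rho : lieModule L S) :
  exists U : {vspace S}, (forall m s, m \in M -> rho m s \in U) /\
    forall W : {vspace S}, (forall m s, m \in M -> rho m s \in W) -> (U <= W)%VS.
Proof.
have [|U MU minU] :=
  @subspace_min _ _ (fun U => forall m s, m \in M -> rho m s \in U) fullv.
  by move=> *; apply: memvf.
exists U; split=> // W MW; apply/capv_idPl/eqP.
rewrite eqEdim capvSl minU // => m s Mm.
by rewrite memv_cap MU ?MW.
Qed.

(** Let U = M S. As M is perfect, U = M U, so the dual of U has no M-invariants, hence
no trivial M-subquotient. But evaluation at an M-invariant v of U is an M-map from
the dual of U to a trivial module, so every linear form on U vanishes at v. *)
Lemma no_invariant_in_span (S : vectType F) (rho : lieModule L S) v :
    (forall U : {vspace S}, (forall m s, m \in M -> rho m s \in U) -> v \in U) ->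
    (forall m, m \in M -> rho m v = 0) ->
  v = 0.
Proof.
move=> spanv invv; have [U [MU minU]] := exists_span_act rho.
have subU : is_submodule rho U.
  have [|a u w Uu Uw x | W memW] :=
    @subspace_of_pred _ _ (fun u => forall x, rho x u \in U).
  - by move=> x; rewrite lact0r mem0v.
  - by rewrite lact_linearr memvD ?memvZ.
  have sUW : (U <= W)%VS.
    apply: minU => m s Mm; apply/memW=> x.
    by rewrite lact_swap memvD ?MU // idM.
  by move=> x u /(subvP sUW)/memW.
have valE (t : subvs_of U) : linfun vsval t = vsval t by rewrite lfunE.
pose tau := Hom_module (submodule subU) (trivial_module L (F^o : vectType F)).
have tauE x phi u : tau x phi u = - phi (submodule subU x u).
  by rewrite Hom_moduleE sub0r.
have inv_tau phi : (forall m, m \in M -> tau m phi = 0) -> phi = 0.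
  move=> phi0; pose W := (linfun vsval @: lker phi)%VS.
  have act_W : act_into M rho U W.
    move=> m u Mm Uu; apply/memv_imgP.
    exists (submodule subU m (vsproj U u)); last by rewrite valE val_submodule vsprojK.
    by rewrite memv_ker -oppr_eq0 -tauE phi0 // zero_lfunE.
  have sUW := minU W (perfect_act_into MU act_W).
  apply/lfunP=> u; have /memv_imgP[u' + ] := subvP sUW _ (subvsP u).
  by rewrite memv_ker valE zero_lfunE => /eqP phiu' /val_inj->.
have nt := no_invariants_no_trivial idM acyclic_irr inv_tau.
have Uv : v \in U by apply: spanv.
have ev_lin : linear (fun phi : 'Hom(subvs_of U, F^o) => phi (vsproj U v)).
  by move=> a phi psi; rewrite add_lfunE scale_lfunE.
have /subvP ker_ev : (fullv <= lker (hom_of ev_lin))%VS.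
  apply: nt => [|m phi _ _|m phi Mm _]; rewrite ?subvf ?memvf //.
  rewrite memv_ker hom_ofE tauE (_ : submodule _ _ _ = 0) ?linear0 ?oppr0 //.
  by apply: val_inj; rewrite [LHS]val_submodule vsprojK // invv // linear0.
have v0 : vsproj U v = 0.
  rewrite (coord_vbasis (memvf (vsproj U v))) big1 // => i _.
  pose phi : 'Hom(subvs_of U, F^o) := linfun (coord (vbasis fullv) i : subvs_of U -> F^o).
  have : phi \in lker (hom_of ev_lin) by apply: ker_ev; apply: memvf.
  by rewrite memv_ker hom_ofE lfunE => /eqP /= ->; rewrite scale0r.
by rewrite -(vsprojK Uv) v0 linear0.
Qed.

End PerfectIdeal.

(** * The p-th power of an inner derivation *)

Section Restricted.
Variables (F : fieldType) (p : nat) (charF : p \in [pchar F]).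
Variables (L : lieAlgType F) (x : L).

Lemma liesumr I (r : seq I) (P : pred I) (G : I -> L) y :
  [lie y, \sum_(i <- r | P i) G i] = \sum_(i <- r | P i) [lie y, G i].
Proof. exact: (big_morph _ (lieDr y) (lie0r y)). Qed.

Lemma lieMnr (y z : L) k : [lie y, z *+ k] = [lie y, z] *+ k.
Proof. by rewrite -scaler_nat lieZr scaler_nat. Qed.

Lemma ad_leibniz (u v : L) : [lie x, [lie u, v]] = [lie [lie x, u], v] + [lie u, [lie x, v]].
Proof. by rewrite lie_lie subrK. Qed.

Let ad k := iter k (lie_bracket x).

Lemma iter_ad_leibniz k (u v : L) :
  ad k [lie u, v] = \sum_(i < k.+1) [lie ad i u, ad (k - i) v] *+ 'C(k, i).
Proof.
elim: k => [|k IHk]; first by rewrite big_ord1.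
rewrite /ad iterS -/(ad _) IHk liesumr.
under eq_bigr do rewrite lieMnr ad_leibniz mulrnDl.
rewrite big_split /= [in RHS]big_ord_recl /= bin0.
under [X in _ = _ + X]eq_bigr do rewrite binS mulrnDr.
rewrite big_split /= [in RHS]addrA addrC; congr (_ + _).
rewrite [LHS]big_ord_recl [X in _ = _ + X]big_ord_recr /= (bin_small (ltnSn k)).
rewrite mulr0n addr0 bin0 subn0; congr (_ + _); apply: eq_bigr => i _.
by rewrite /ad /bump /= !add1n subSS -(subnSK (ltn_ord i)).
Qed.

(** The inner binomial coefficients in Leibniz's rule are divisible by p. *)
Lemma ad_pth_derivation (u v : L) :
  ad p [lie u, v] = [lie ad p u, v] + [lie u, ad p v].
Proof.
have pr_p := pcharf_prime charF.
have def_p := esym (prednK (prime_gt0 pr_p)); set q := p.-1 in def_p.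
rewrite def_p iter_ad_leibniz big_ord_recl bin0 subn0 addrC big_ord_recr.
rewrite big1 => [|i _]; rewrite /= /bump !add1n ?subnn ?binn ?add0r //.
have /dvdnP[c ->] : (p %| 'C(q.+1, i.+1))%N.
  by rewrite -def_p prime_dvd_bin // def_p /= ltnS ltn_ord.
by rewrite mulrnA -scaler_nat (pcharf0 charF) scale0r.
Qed.

End Restricted.

(** * There is no nonzero perfect ideal contained in all others *)

Section LeastPerfectIdeal.
Variables (F : fieldType) (p : nat) (charF : p \in [pchar F]).
Variables (L : lieAlgType F) (M : {vspace L}).
Hypotheses (idM : is_ideal M) (perfM : (M <= liespan M M)%VS).
Hypothesis leastM : forall I : {vspace L}, is_ideal I -> I <> 0%VS -> (M <= I)%VS.
Hypothesis acyclic_irr : forall (S : vectType F) (rho : lieModule L S),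
  irreducible rho -> ~ (M <= Ann_space rho)%VS -> acyclic rho.

Let subM : is_submodule (adjoint_module L) M.
Proof. by move=> x y; apply: idM. Qed.

(** The derivation (ad x)^p maps L to M, so it is a cocycle with values in M. As an
L-module M is irreducible and M acts nontrivially on it, so it has no H^1. *)
Lemma ad_pth_inner x : M <> 0%VS -> x \in M ->
  exists2 x', x' \in M & forall w, iter p (lie_bracket x) w = [lie x', w].
Proof.
move=> nzM Mx.
have irrM : irreducible (submodule subM).
  split=> [M0 | T subT].
    have [u Mu nzu] := exists_nonzero nzM; case/negP: nzu.
    have := memvf (vsproj M u); rewrite M0 memv0 => /eqP u0.
    by rewrite -(vsprojK Mu) u0 linear0.
  have [-> | /eqP nzT] := eqVneq T 0%VS; [by left | right].
  have valE (t : subvs_of M) : linfun vsval t = vsval t by rewrite lfunE.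
  pose T' := (linfun vsval @: T)%VS.
  have sMT : (M <= T')%VS.
    apply: leastM.
      move=> y _ /memv_imgP[t Tt ->]; apply/memv_imgP.
      by exists (submodule subM y t); rewrite ?subT // !valE val_submodule.
    move=> T'0; apply: nzT; apply/eqP; rewrite -subv0; apply/subvP=> t Tt.
    have := memv_img (linfun vsval) Tt; rewrite -/T' T'0 !memv0 valE => /eqP t0.
    by apply/eqP/val_inj; rewrite [LHS]t0 linear0.
  apply/eqP; rewrite eqEsubv subvf; apply/subvP=> t _.
  have /memv_imgP[u Tu] := subvP sMT _ (subvsP t).
  by rewrite valE => /val_inj->.
have MactM : ~ (M <= Ann_space (submodule subM))%VS.
  move=> sMA; apply: nzM; apply/eqP; rewrite -subv0 (subv_trans perfM) //.
  apply/liespanP=> a c Ma Mc; rewrite memv0; apply/eqP.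
  have /Ann_spaceP/(_ (vsproj M c))/(congr1 vsval) := subvP sMA a Ma.
  by rewrite val_submodule vsprojK // linear0.
have M_iter k w : iter k.+1 (lie_bracket x) w \in M.
  elim: k => [|k IHk]; last exact: idM.
  by rewrite /= lieC memvN idM.
have M_pth w : iter p (lie_bracket x) w \in M.
  by rewrite -(prednK (prime_gt0 (pcharf_prime charF))) M_iter.
have pth_linear : linear (fun w => vsproj M (iter p (lie_bracket x) w)).
  move=> a u v; rewrite -linearP; congr (vsproj M _).
  by elim: (p) => //= k ->; rewrite lie_linearr.
pose f := hom_of pth_linear.
have fE w : vsval (f w) = iter p (lie_bracket x) w by rewrite hom_ofE vsprojK.
have [u v | s fs] := acyclic_irr irrM MactM (f := f).
  apply: val_inj; rewrite [LHS]fE [RHS]subvs_valB !val_submodule !fE.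
  by rewrite (ad_pth_derivation charF) addrC [X in _ + X]lieC.
exists (- vsval s); first by rewrite memvN subvsP.
by move=> w; rewrite -fE fs val_submodule lieNl -lieC.
Qed.

(** If M != 0, then for x in M and w in L the element [x, w]^p of S^p(L) is invariant
and lies in M S^p(L), hence vanishes; so M centralizes L. *)
Lemma least_perfect_ideal_zero : M = 0%VS.
Proof.
apply: boolp.contrapT => nzM.
suff abM x w : x \in M -> [lie x, w] = 0.
  apply: nzM; apply/eqP; rewrite -subv0 (subv_trans perfM) //.
  by apply/liespanP=> a c Ma _; rewrite abM ?mem0v.
move=> Mx; have [x' Mx' pthE] := ad_pth_inner nzM Mx.
have [n dimL] : exists n, \dim (fullv : {vspace L}) = n.+1.
  exists (\dim (fullv : {vspace L})).-1; rewrite prednK // lt0n dimv_eq0.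
  by apply/eqP=> L0; apply: nzM; apply/eqP; rewrite -subv0 -L0 subvf.
move: (vbasis (fullv : {vspace L})) (vbasisP (fullv : {vspace L})).
rewrite dimL => b basis_b.
have def_p := esym (prednK (prime_gt0 (pcharf_prime charF))).
have charF' : p.-1.+1 \in [pchar F] by rewrite -def_p.
apply: (pth_power_inj (b := b) basis_b (q := p.-1)).
apply: (no_invariant_in_span idM perfM acyclic_irr (rho := sym_module basis_b p.-1)).
  move=> U MU; apply: (pth_power_mem (basis_b := basis_b) charF' w perfM Mx Mx') => // u.
  by rewrite -def_p.
by move=> m _; apply: (pth_power_invariant basis_b charF').
Qed.

End LeastPerfectIdeal.

(** * Derived series and quotients *)

Section Quotients.
Variables (F : fieldType) (L : lieAlgType F).

Definition all_Ann_acyclic : Prop :=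
  forall (S : vectType F) (rho : lieModule L S), irreducible rho -> Ann_acyclic rho.

Lemma derived_ideal n : is_ideal (lie_derived L n).
Proof.
elim: n => [|n IHn] x y; first by move=> _; apply: memvf.
have [|a u v Du Dv | W memW] := @subspace_of_pred _ _
  (fun y => [lie x, y] \in lie_derived L n.+1).
- by rewrite lie0r mem0v.
- by rewrite lie_linearr memvD ?memvZ.
move=> Dy; apply/memW; apply: subvP Dy; apply/liespanP=> a c Da Dc; apply/memW.
by rewrite ad_leibniz memvD // mem_liespan // IHn.
Qed.

Lemma derivedS n : (lie_derived L n.+1 <= lie_derived L n)%VS.
Proof. by apply/liespanP=> x y _ Dy; apply: derived_ideal. Qed.

Lemma derived_stable : exists n, lie_derived L n.+1 = lie_derived L n.
Proof.
apply: boolp.contrapT => no_n.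
have dec n : (\dim (lie_derived L n) + n <= \dim (fullv : {vspace L}))%N.
  elim: n => [|n IHn]; first by rewrite addn0.
  apply: leq_trans IHn; rewrite addnS ltn_add2r ltn_neqAle dimvS ?derivedS // andbT.
  apply/eqP=> e; apply: no_n; exists n; apply/eqP.
  by rewrite eqEdim derivedS e /=.
have := dec (\dim (fullv : {vspace L})).+1.
by rewrite addnS ltnNge leq_addl.
Qed.

Lemma derived_lpi (I : lieIdeal L) n :
  lie_derived (lieQuot I) n = (lpi I @: lie_derived L n)%VS.
Proof.
elim: n => [|n IHn]; first by rewrite [RHS]vpi_surj.
rewrite [LHS]/(liespan (lie_derived _ n) (lie_derived _ n)) IHn.
apply/eqP; rewrite eqEsubv; apply/andP; split.
  apply/liespanP=> _ _ /memv_imgP[x Dx ->] /memv_imgP[y Dy ->].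
  by rewrite -lpi_morphism memv_img // mem_liespan.
have memP W x : (x \in (lpi I @^-1: W)%VS) = (lpi I x \in W) by rewrite -memv_preim.
suff /subvP sD : (lie_derived L n.+1 <= lpi I @^-1:
    liespan (lpi I @: lie_derived L n) (lpi I @: lie_derived L n))%VS.
  by apply/subvP=> v /memv_imgP[x /sD + ->]; rewrite memP.
apply/liespanP=> x y Dx Dy; rewrite memP lpi_morphism mem_liespan // memv_img //.
Qed.

Lemma quotient_solvable (I : lieIdeal L) : lie_solvable L -> lie_solvable (lieQuot I).
Proof. by case=> n Dn; exists n; rewrite derived_lpi Dn limg0. Qed.

Definition inflation (I : lieIdeal L) (S : vectType F) (rho : lieModule (lieQuot I) S) :
  lieModule L S.
Proof.
exists (fun x => rho (lpi I x)).
- by move=> s a x y; rewrite linearP lact_linearl.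
- by move=> x; apply: lact_linearr.
- by move=> x y s; rewrite lpi_morphism lact_lie.
Defined.

End Quotients.

(** * Solvability *)

Section Solvable.
Variables (F : fieldType) (p : nat) (charF : p \in [pchar F]).

Lemma inflation_irreducible (L : lieAlgType F) (I : lieIdeal L) (S : vectType F)
    (rho : lieModule (lieQuot I) S) : irreducible rho -> irreducible (inflation rho).
Proof.
case=> nzS irrS; split=> // T subT; apply: irrS => u t Tt.
by rewrite -[u]lreprK; apply: subT.
Qed.

Lemma quotient_all_Ann_acyclic (L : lieAlgType F) (I : lieIdeal L) :
  all_Ann_acyclic L -> all_Ann_acyclic (lieQuot I).
Proof.
move=> acycL S rho irrS f Zf f0.
have [x y | x Ax | s fs] := acycL S _ (inflation_irreducible irrS) (f \o lpi I)%VF.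
- by rewrite !comp_lfunE lpi_morphism Zf.
- rewrite comp_lfunE f0 //; apply/Ann_spaceP=> s.
  by have /Ann_spaceP/(_ s) := Ax.
by exists s => u; rewrite -[u]lreprK -comp_lfunE fs.
Qed.

(** Quotients inherit the hypothesis, so by induction all proper quotients are solvable
and the stable term M of the derived series lies in every nonzero ideal. If M acts
nontrivially on an irreducible module, the annihilator of the module is then zero,
and the condition on cocycles vanishing on the annihilator is void. *)
Lemma all_Ann_acyclic_solvable (L : lieAlgType F) : all_Ann_acyclic L -> lie_solvable L.
Proof.
have [n] := ubnP (\dim (fullv : {vspace L})); elim: n L => // n IHn L.
rewrite ltnS => le_n acycL; have [k Dk] := derived_stable L.
set M := lie_derived L k in Dk; exists k.
have idM : is_ideal M := @derived_ideal _ L k.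
have perfM : (M <= liespan M M)%VS by rewrite -[X in (_ <= X)%VS]/(lie_derived L k.+1) Dk.
have leastM I : is_ideal I -> I <> 0%VS -> (M <= I)%VS.
  move=> idI nzI; pose LI := LieIdeal idI.
  have [||m Dm] := IHn (lieQuot LI); last 1 first.
  - have sDI : (lie_derived L m <= I)%VS.
      apply/subvP=> x Dx; apply/(lpi_eq0 LI)/eqP; rewrite -memv0 -Dm derived_lpi.
      exact: memv_img.
    suff sMD j : (M <= lie_derived L j)%VS by apply: subv_trans sDI.
    elim: j => [|j IHj]; first exact: subvf.
    apply: subv_trans perfM _; apply/liespanP=> x y Mx My.
    by rewrite mem_liespan ?(subvP IHj).
  - apply: leq_trans le_n; rewrite -(limg_ker_dim (lpi LI) fullv) vpi_surj lker_vpi.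
    rewrite capfv -[X in (X < _)%N]add0n ltn_add2r lt0n dimv_eq0; exact/eqP.
  exact: quotient_all_Ann_acyclic.
apply: (least_perfect_ideal_zero charF idM perfM leastM) => S rho irrS MS f Zf.
apply: acycL => // x Ax; suff -> : x = 0 by rewrite linear0.
apply/eqP; rewrite -memv0; suff <- : Ann_space rho = 0%VS by [].
apply: boolp.contrapT => nzA; apply: MS; apply: leastM nzA; exact: Ann_ideal.
Qed.

(** L / Ann S acts faithfully on S, and the last nonzero term of its derived series is
an abelian ideal. *)
Lemma solvable_Ann_module_acyclic (L : lieAlgType F) (S : vectType F)
    (rho : lieModule L S) :
  lie_solvable L -> irreducible rho -> acyclic (Ann_module rho).
Proof.
move=> solL irrS; set Lbar := lieQuot (Ann rho).
have irrA : irreducible (Ann_module rho).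
  case: irrS => nzS irrS; split=> // T subT; apply: irrS => x t Tt.
  by rewrite -Ann_moduleE; apply: subT.
have faithful u : (forall s, Ann_module rho u s = 0) -> u = 0.
  move=> u0; rewrite -[u]lreprK; apply/(lpi_eq0 (Ann rho))/Ann_spaceP=> s.
  by rewrite -Ann_moduleE lreprK.
have [n Dn] := quotient_solvable (Ann rho) solL.
have exn : exists n, lie_derived Lbar n == 0%VS by exists n; apply/eqP.
case: (ex_minnP exn) => -[|k] /eqP Dk minn.
  move=> f Zf; exists 0 => u; suff -> : u = 0 by rewrite linear0 lact0r.
  by apply/eqP; rewrite -memv0 -Dk memvf.
apply: (abelian_ideal_acyclic charF (A := lie_derived Lbar k)) => //.
- exact: derived_ideal.
- move=> a c Da Dc; apply/eqP; rewrite -memv0 -Dk; exact: mem_liespan.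
- move/subvP=> sDA; suff /minn : lie_derived Lbar k == 0%VS by rewrite ltnn.
  rewrite -subv0; apply/subvP=> u /sDA/Ann_spaceP/faithful->; exact: mem0v.
Qed.

End Solvable.

Theorem theorem4p3 (F : fieldType) (p : nat) (charF : p \in [pchar F])
    (L : lieAlgType F) (C : chiefSeries L) :
  [<-> lie_solvable L;
       forall (S : vectType F) (rho : lieModule L S), irreducible rho ->
         H1 (Ann_module rho) = 0%VS;
       forall (S : vectType F) (rho : lieModule L S), irreducible rho ->
         \dim (H1 rho) = (\dim (End_L rho) * split_mult C rho)%N].
Proof.
tfae=> [solL S rho irrS | acycAnn S rho irrS | dimH1].
- exact/H1_eq0P/(solvable_Ann_module_acyclic charF).
- exact/(dim_H1_split_mult irrS)/Ann_acyclic_of_module/H1_eq0P/acycAnn.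
- apply: (all_Ann_acyclic_solvable charF) => S rho irrS.
  exact/(dim_H1_split_mult irrS C)/dimH1.
Qed.
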